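(* There exist a group $G$ generated by a finite set $S$ and an element $a\in S$ such that: the map $n\mapsto a^n$ is an isometric embedding of $\mathbb{Z}$ into $\mathrm{Cay}(G,S)$; $a$ is a generalized loxodromic element of $G$; but $\langle a\rangle$ is not $\rho$-contracting in $\mathrm{Cay}(G,S)$ for any $\rho$ such that $\liminf_{r\to\infty}\rho(r)\log(r)/r=0$.
   Context: An action of a group $G$ by isometries on a metric space $X$ is acylindrical if for all $d\ge 0$ there exist constants $M,N\ge 0$ such that for all $x,y\in X$ with $d(x,y)\ge M$, the number of elements $g\in G$ satisfying $d(x,gx)\le d$ and $d(y,gy)\le d$ is at most $N$. An element $g\in G$ is generalized loxodromic if there is an acylindrical action of $G$ on a (Gromov) hyperbolic space $X$ such that $g$ acts loxodromically. $\mathrm{Cay}(G,S)$ is the Cayley graph, with its path metric. For a subset $Y$ of the vertex set of a graph $X$, the closest point projection is $\pi_Y(x)=\{y\in Y : d(x,y)\le d(x,Y)\}$. Given a non-decreasing function $\rho:[0,\infty)\to[0,\infty)$ with $\rho(r)/r\to 0$ as $r\to\infty$, $Y$ is called $\rho$-contracting if for any two points $x,z\in X$ with $d(x,z)\le d(x,Y)$ one has $\mathrm{diam}(\pi_Y(x)\cup\pi_Y(z))\le\rho(d(x,Y))$. *)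

(* Defs.v *)
From HB Require Import structures.
From mathcomp Require Import all_boot all_order all_algebra finmap.
From mathcomp Require Import all_classical all_reals all_analysis.

Set Implicit Arguments.
Unset Strict Implicit.
Unset Printing Implicit Defensive.

Import Order.TTheory GRing.Theory Num.Theory.
Import numFieldTopology.Exports numFieldNormedType.Exports.

Local Open Scope classical_set_scope.
Local Open Scope ring_scope.

Section Groups.
Variable G : groupType.

Definition zpow (g : G) (n : int) : G :=
  match n with Posz k => (g ^+ k)%g | Negz k => (g ^- k.+1)%g end.

Definition generates (S : {fset G}) : Prop :=
  forall H : {pred G}, group_closed H -> {subset S <= H} -> forall g, g \in H.

(* The Cayley graph is taken as a simple graph: edges labelled by an involution
   or by two mutually inverse generators are not doubled, and the trivial
   element gives no loop. *)
Definition cayley_edge (S : {fset G}) : rel G := fun g h =>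
  (g != h) && ((g^-1 * h \in S) || (h^-1 * g \in S))%g.

End Groups.

Section Graphs.
Variables (R : realType) (V : eqType) (e : rel V).

(* [inf] of the empty set is 0, so this is meaningful for connected graphs. *)
Definition vertex_dist (u v : V) : R :=
  inf [set (size p)%:R | p in [set p : seq V | path e u p /\ last u p = v]].

(* Points of the geometric realization. A point may have several
   representatives (a vertex is also an end of each incident edge, and
   [REdge u v t] is [REdge v u (1 - t)]); these are at distance 0 for
   [path_dist]. *)
Inductive realization : Type :=
  | RVertex of V
  | REdge (u v : V) (t : R) of e u v & 0 <= t <= 1.

Definition ends (x : realization) : seq (V * R) :=
  match x with
  | RVertex v => [:: (v, 0)]
  | REdge u v t _ _ => [:: (u, t); (v, 1 - t)]
  end.

(* Lengths of the paths from x to y which run through vertices. *)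
Definition vertex_path_lengths (x y : realization) : set R :=
  [set l | exists a b, [/\ a \in ends x, b \in ends y
                         & l = a.2 + vertex_dist a.1 b.1 + b.2]].

(* Length of the segment from x to y when both lie on a common edge. *)
Definition edge_path_lengths (x y : realization) : set R :=
  match x, y with
  | REdge u v t _ _, REdge u' v' t' _ _ =>
      [set l | [/\ u' = u, v' = v & l = `|t - t'|]
            \/ [/\ u' = v, v' = u & l = `|t - (1 - t')|]]
  | _, _ => set0
  end.

Definition path_dist (x y : realization) : R :=
  inf (vertex_path_lengths x y `|` edge_path_lengths x y).

End Graphs.

Arguments RVertex {R V e}.

Section Contraction.
Variables (R : realType) (X : Type) (d : X -> X -> R).

Definition dist_to (Y : set X) (x : X) : R := inf [set d x y | y in Y].

Definition closest_proj (Y : set X) (x : X) : set X :=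
  [set y | Y y /\ d x y <= dist_to Y x].

Definition diam (A : set X) : \bar R :=
  ereal_sup [set (d p.1 p.2)%:E | p in A `*` A].

Definition contracting (rho : R -> R) (Y : set X) : Prop :=
  forall x z, d x z <= dist_to Y x ->
    (diam (closest_proj Y x `|` closest_proj Y z) <= (rho (dist_to Y x))%:E)%E.

End Contraction.

Section Gauges.
Variable R : realType.

(* The functions [0, oo) -> [0, oo) for which rho-contraction is defined; the
   values of rho at negative reals are irrelevant. *)
Definition contraction_gauge (rho : R -> R) : Prop :=
  [/\ forall r, 0 <= r -> 0 <= rho r,
      forall r s, 0 <= r -> r <= s -> rho r <= rho s
    & rho r / r @[r --> +oo] --> (0 : R)].

End Gauges.

Section Hyperbolic.
Variables (R : realType) (X : metricType R).

Definition geodesic (x y : X) (c : R -> X) : Prop :=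
  [/\ c 0 = x, c (mdist x y) = y
    & forall s t, 0 <= s <= mdist x y -> 0 <= t <= mdist x y ->
        mdist (c s) (c t) = `|s - t|].

Definition geodesic_space : Prop := forall x y : X, exists c, geodesic x y c.

(* As x, y, z and the sides are arbitrary and geodesics can be reversed, it is
   enough to ask this of one side of the triangle. *)
Definition slim_triangles (delta : R) : Prop :=
  forall (x y z : X) (p q r : R -> X),
    geodesic x y p -> geodesic y z q -> geodesic x z r ->
    forall s, 0 <= s <= mdist x y ->
      (exists2 t, 0 <= t <= mdist y z & mdist (p s) (q t) <= delta) \/
      (exists2 t, 0 <= t <= mdist x z & mdist (p s) (r t) <= delta).

Definition hyperbolic_space : Prop :=
  geodesic_space /\ exists2 delta, 0 <= delta & slim_triangles delta.

End Hyperbolic.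

Section Actions.
Variables (R : realType) (G : groupType) (X : metricType R).
Variable act : G -> X -> X.

Definition isometric_action : Prop :=
  [/\ forall x, act 1%g x = x,
      forall g h x, act (g * h)%g x = act g (act h x)
    & forall g x y, mdist (act g x) (act g y) = mdist x y].

Definition acylindrical : Prop :=
  forall d : R, 0 <= d -> exists (M : R) (N : nat), 0 <= M /\
    forall x y : X, M <= mdist x y ->
      ([set g | mdist x (act g x) <= d /\ mdist y (act g y) <= d] #<= `I_N)%card.

Definition acts_loxodromically (g : G) : Prop :=
  exists (x : X) (L C : R), [/\ 1 <= L, 0 <= C & forall m n : int,
    `|m - n|%:~R / L - C <= mdist (act (zpow g m) x) (act (zpow g n) x)
      <= L * `|m - n|%:~R + C].

End Actions.

Definition generalized_loxodromic (R : realType) (G : groupType) (g : G) :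
    Prop :=
  exists (X : metricType R) (act : G -> X -> X),
    [/\ hyperbolic_space X, isometric_action act, acylindrical act
      & acts_loxodromically act g].

Definition Cay (R : realType) (G : groupType) (S : {fset G}) : Type :=
  realization R (cayley_edge S).

Definition cay_vertex (R : realType) (G : groupType) (S : {fset G}) (g : G) :
    Cay R S := RVertex g.

Definition cay_dist (R : realType) (G : groupType) (S : {fset G})
    (x y : Cay R S) : R := path_dist x y.

(* Main.v *)
Require Import Defs.
From HB Require Import structures.
From mathcomp Require Import all_boot all_order all_algebra finmap.
From mathcomp Require Import generic_quotient perm.
From mathcomp Require Import all_classical all_reals all_analysis.
From mathcomp Require Import zify ring lra.

Set Implicit Arguments.
Unset Strict Implicit.
Unset Printing Implicit Defensive.

Import Order.TTheory GRing.Theory Num.Theory.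
Import numFieldTopology.Exports numFieldNormedType.Exports.

Local Open Scope classical_set_scope.
Local Open Scope ring_scope.

(** Let a act loxodromically, and suppose that a homomorphism to Z kills a,
    sends c to 1 and is bounded by 1 on the finite generating set S, which
    contains a and c. Then every c^m is at distance exactly m from <a>, with
    1 among its closest points. Translating by a^k, the point a^k c^m is
    again at distance m from <a>, with a^k among its closest points. These
    two points differ by c^-m a^k c^m = (c^-m a c^m)^k, so they are at
    distance at most k l, where l is the word length of c^-m a c^m. Taking k
    about m / l, a contraction function rho must satisfy rho(m) >= m / l, up
    to rounding. It remains to find a group in which l = O(log m) along m =
    2^j, although a is a generalized loxodromic element.

    The logarithm comes from the exponential distortion of z in the
    Baumslag-Solitar group Q = <z, s | s z s^-1 = z^2>, where z^(2^j) = s^j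
    z s^-j. Let Q x <c> be extended by involutions x and y, where c commutes
    with x and c z commutes with y, and nothing else is imposed. For a = x y
    this gives c^-m a c^m = x (z^m y z^-m) = a y^-1 (z^m y z^-m), which has
    length at most 4j + 5 when m = 2^j.

    The conjugates of x and y generate a free product F of two factors: the
    conjugates of x by Q x <c> generate one, those of y the other, and each
    factor is itself a free product of groups of order two indexed by the
    cosets of <c>, respectively <c z>. The group is the semidirect product
    of F and Q x <c>, and it acts on the Bass-Serre tree of the splitting of
    F into two factors. An element that fixes a long segment is conjugate to
    an element of Q x <c> fixing a nontrivial element in each of the two
    factors, hence fixing a conjugate of x and one of y; so it lies both in
    <c> and in a conjugate of <c z>, and these intersect trivially. This
    makes the action acylindrical ([discrete_acylindrical],
    [ambient_small_stabilizers]), and a = x y is loxodromic because its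
    powers are reduced words of length 2n.

    The tree is obtained from the syllable length of F alone: this length
    satisfies the four-point condition, so its Gromov product satisfies the
    ultrametric inequality, and the points of the tree are pairs (g, t),
    where t is a distance from the base point along the segment to g.
    Acylindricity passes to subgroups, so the acting group is first taken
    with all rational translations instead of the dyadic ones of Q, and then
    cut down to the subgroup generated by a, y, z, s and c
    ([slow_contraction_criterion]). *)

(** * Tree lengths on groups *)

(** A base point orbit in a tree, seen from the group: [tlen g] is the distance
    from the base point to its image under g. [tlen_hyp] is the four-point
    condition with the base point as fourth point, and [tlen_prefix] says that
    the segment to an orbit point meets the orbit at all integer times. The
    length may vanish on a nontrivial stabilizer. *)
Record tree_length (G : groupType) := TreeLength {
  tlen :> G -> nat;
  tlen1 : tlen 1%g = 0%N;
  tlenV : forall g, tlen g^-1%g = tlen g;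
  tlen_hyp : forall g h k, (tlen (g^-1 * k)%g + tlen h <=
    maxn (tlen (g^-1 * h)%g + tlen k) (tlen (h^-1 * k)%g + tlen g))%N;
  tlen_prefix : forall g k, (k <= tlen g)%N ->
    exists2 h, tlen h = k & tlen (h^-1 * g)%g = (tlen g - k)%N
}.

Section TreeLength.
Variables (G : groupType) (L : tree_length G).

Definition tdist (g h : G) : nat := L (g^-1 * h)%g.

Lemma tdistxx g : tdist g g = 0%N.
Proof. by rewrite /tdist mulVg tlen1. Qed.

Lemma tdistC g h : tdist g h = tdist h g.
Proof. by rewrite /tdist -tlenV invgM invgK. Qed.

Lemma tdistM k g h : tdist (k * g)%g (k * h)%g = tdist g h.
Proof. by rewrite /tdist invgM -mulgA mulKg. Qed.

Lemma tdist1g g : tdist 1%g g = L g.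
Proof. by rewrite /tdist invg1 mul1g. Qed.

Lemma tdistg1 g : tdist g 1%g = L g.
Proof. by rewrite tdistC tdist1g. Qed.

Lemma tdistMr g h : tdist g (g * h)%g = L h.
Proof. by rewrite /tdist mulKg. Qed.

(** By invariance the four-point condition at the base point gives it at any
    four points. *)
Lemma tdist4 x y z w : (tdist x y + tdist z w <=
  maxn (tdist x z + tdist y w) (tdist x w + tdist y z))%N.
Proof.
have := tlen_hyp L (w^-1 * x)%g (w^-1 * z)%g (w^-1 * y)%g.
rewrite -!/(tdist _ _) !tdistM (tdistC w z) (tdistC w y) (tdistC w x) (tdistC z y).
lia.
Qed.

Lemma tdist_triangle x y z : (tdist x z <= tdist x y + tdist y z)%N.
Proof.
have := tdist4 x z y y; rewrite tdistxx (tdistC z y); lia.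
Qed.

(** In tree terms: only the identity fixes two orbit points at distance at
    least 2. *)
Definition small_stabilizers :=
  forall k p, L k = 0%N -> L (p^-1 * (k * p))%g = 0%N -> (1 < L p)%N -> k = 1%g.

(** If h moves both ends of the segment [1, g] by at most D, it translates the
    middle of the segment along the segment: the image of a middle point p lies on
    [1, g], at a position that differs from that of p by an amount independent
    of p. All follows from the four-point condition, where the assumptions
    decide which of the three sums is smallest. *)
Lemma almost_fixed_translate (D i : nat) (g h p : G) :
  (L h <= D)%N -> (tdist g (h * g)%g <= D)%N ->
  (D < i)%N -> (i + D < L g)%N -> L p = i -> tdist p g = (L g - i)%N ->
  (L (h * p)%g + L g = tdist 1%g (h * g)%g + i /\
   L (h * p)%g + tdist (h * p)%g g = L g)%N.
Proof.
move=> hD gD Di iD Lp pg.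
have e1 : tdist h (h * p)%g = i by rewrite tdistMr.
have e2 : tdist (h * p)%g (h * g)%g = (L g - i)%N by rewrite tdistM.
have e3 : tdist h (h * g)%g = L g by rewrite tdistMr.
have := tdist4 1%g h (h * p)%g (h * g)%g.
have := tdist4 1%g (h * p)%g h (h * g)%g.
have := tdist4 1%g (h * g)%g h (h * p)%g.
have := tdist4 g (h * g)%g (h * p)%g h.
have := tdist4 g (h * p)%g h (h * g)%g.
have := tdist4 g h (h * p)%g (h * g)%g.
have := tdist4 1%g h g (h * g)%g.
have := tdist4 1%g g h (h * g)%g.
have := tdist4 1%g (h * g)%g g h.
have := tdist_triangle 1%g h (h * g)%g.
have := tdist_triangle 1%g g (h * g)%g.
have := tdist_triangle 1%g (h * g)%g g.
have := tdist_triangle 1%g h g.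
have := tdist_triangle h 1%g g.
rewrite !(tdistC (h * p)%g h) !(tdistC (h * g)%g h) !(tdistC (h * g)%g (h * p)%g).
rewrite !(tdistC (h * g)%g g) !(tdistC (h * p)%g g) !(tdistC h g) !(tdistC h 1%g).
rewrite e1 e2 e3 !tdist1g; lia.
Qed.

(** The key of h is the position of the image of a point p of [1, g]. It takes
    boundedly many values, and it determines the image of the whole middle of
    the segment; so two elements with the same key differ by an element that
    fixes p and a second point q at distance 2 from p. *)
Lemma discrete_acylindrical : small_stabilizers -> forall D : nat,
  exists M N : nat, forall g, (M <= L g)%N ->
  exists key : G -> nat,
    {in [pred h | (L h <= D)%N && (tdist g (h * g)%g <= D)%N],
      forall h, (key h < N)%N} /\
    {in [pred h | (L h <= D)%N && (tdist g (h * g)%g <= D)%N] &, injective key}.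
Proof.
move=> stab D; exists (D + D + 4)%N, (D + D.+2)%N => g Lg.
have mg : (D.+3 <= L g)%N by lia.
have [q Lq qg] := tlen_prefix mg.
have mq : (D.+1 <= L q)%N by lia.
have [p Lp pq] := tlen_prefix mq.
rewrite -!/(tdist _ _) in qg pq.
have pg : tdist p g = (L g - D.+1)%N.
  have := tdist_triangle p q g; have := tdist_triangle 1%g p g.
  by rewrite !tdist1g; lia.
exists (fun h => L (h * p)%g); split=> [h|h h'].
  move=> /andP[hD _]; have := tdist_triangle 1%g h (h * p)%g.
  by rewrite tdistMr !tdist1g; lia.
move=> /andP[hD hg] /andP[h'D h'g] E.
have same i r : (D < i)%N -> (i + D < L g)%N -> L r = i ->
    tdist r g = (L g - i)%N -> L (h * r)%g = L (h' * r)%g ->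
    tdist (h * r)%g (h' * r)%g = 0%N.
  move=> Di iD Lr rg Er.
  have [_ e1] := almost_fixed_translate hD hg Di iD Lr rg.
  have [_ e2] := almost_fixed_translate h'D h'g Di iD Lr rg.
  have := tdist4 (h * r)%g (h' * r)%g 1%g g.
  by rewrite !tdist1g !tdistg1; lia.
have sp : tdist (h * p)%g (h' * p)%g = 0%N by apply: (@same D.+1); lia.
have sq : tdist (h * q)%g (h' * q)%g = 0%N.
  apply: (@same D.+3); rewrite ?qg//; try lia.
  have [e1 _] := @almost_fixed_translate D D.+1 _ _ _ hD hg (leqnn _)
     ltac:(lia) Lp pg.
  have [e2 _] := @almost_fixed_translate D D.+1 _ _ _ h'D h'g (leqnn _)
     ltac:(lia) Lp pg.
  have [e3 _] := @almost_fixed_translate D D.+3 _ _ _ hD hg ltac:(lia)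
     ltac:(lia) Lq qg.
  have [e4 _] := @almost_fixed_translate D D.+3 _ _ _ h'D h'g ltac:(lia)
     ltac:(lia) Lq qg.
  by lia.
pose k := ((h^-1 * h') ^ p)%g.
suff /eqP : k = 1%g by rewrite conjg_eq1 mulg_eq1 => /eqP /invg_inj.
apply: (stab k (p^-1 * q)%g).
- by move: sp; rewrite /tdist /k conjgE invgM !mulgA.
- by move: sq; rewrite /tdist /k conjgE !(invgM, invgK, mulgA, mulgK, mulgVK).
- have := tdist_triangle p q g; rewrite -/(tdist p q); lia.
Qed.

End TreeLength.

(** * The metric tree of a tree length *)

(* The innermost minimum on the right is treated first, so that no comparison
   ever involves another minimum. *)
Ltac case_min := rewrite /=; repeat match goal with
  |- context [Order.min ?a ?b] =>
    lazymatch b with context [Order.min _ _] => fail | _ => idtac end;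
    case: (leP a b) => ? end.

Section PointedTree.
Variables (R : realType) (G : groupType) (L : tree_length G).

Local Notation "'ell' g" := ((L g)%:R : R) (at level 10).
Local Notation d g h := ((tdist L g h)%:R : R).

Definition gromov (g h : G) : R := (ell g + ell h - d g h) / 2.

Lemma gromovC g h : gromov g h = gromov h g.
Proof. by rewrite /gromov tdistC (addrC (ell g)). Qed.

Lemma tdistE g h : d g h = ell g + ell h - 2 * gromov g h.
Proof. by rewrite /gromov; field. Qed.

Lemma tdist4R x y z w : d x y + d z w <= d x z + d y w \/
                        d x y + d z w <= d x w + d y z.
Proof.
have := tdist4 L x y z w; rewrite -!natrD !ler_nat; lia.
Qed.

Lemma tdist_triangleR x y z : d x z <= d x y + d y z.
Proof. by rewrite -natrD ler_nat; exact: tdist_triangle. Qed.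

Lemma gromov_ge0 g h : 0 <= gromov g h.
Proof.
have := tdist_triangleR g 1%g h; rewrite /gromov tdistg1 tdist1g; lra.
Qed.

Lemma gromov_lel g h : gromov g h <= ell g.
Proof.
have := tdist_triangleR 1%g g h; rewrite /gromov !tdist1g; lra.
Qed.

Lemma gromov_ler g h : gromov g h <= ell h.
Proof. by rewrite gromovC gromov_lel. Qed.

Lemma gromovxx g : gromov g g = ell g.
Proof. by rewrite /gromov tdistxx; field. Qed.

(** The four-point condition at the base point, in terms of Gromov products:
    two segments from the base point that both follow a third one up to some
    point agree up to there. *)
Lemma gromov_ultra g h k : gromov g h <= gromov g k \/ gromov h k <= gromov g k.
Proof.
have := tdist4R g k h 1%g; rewrite !tdistg1 /gromov (tdistC L k h); lra.
Qed.

(** The point at distance t from the base point on the segment to g. *)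
Definition point := {p : G * R | 0 <= p.2 <= ell p.1}.

Lemma height_ge0 (p : point) : 0 <= (val p).2.
Proof. by case: p => -[g t] /= /andP[]. Qed.

Lemma height_le (p : point) : (val p).2 <= ell (val p).1.
Proof. by case: p => -[g t] /= /andP[]. Qed.

(** How long the segments from the base point to p and to q coincide. *)
Definition meet (p q : point) : R :=
  Num.min (val p).2 (Num.min (val q).2 (gromov (val p).1 (val q).1)).

Definition pdist (p q : point) : R := (val p).2 + (val q).2 - 2 * meet p q.

Lemma meetC p q : meet p q = meet q p.
Proof. by rewrite /meet gromovC minCA. Qed.

Lemma meetxx p : meet p p = (val p).2.
Proof.
have := height_le p; rewrite /meet gromovxx; case_min; lra.
Qed.

Lemma meet_lel p q : meet p q <= (val p).2.
Proof. by rewrite /meet; case_min; lra. Qed.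

Lemma meet_ler p q : meet p q <= (val q).2.
Proof. by rewrite meetC meet_lel. Qed.

(** This inequality alone yields the triangle inequality and the four-point
    condition for [pdist]. *)
Lemma meet_ultra p q r : meet p q <= meet p r \/ meet q r <= meet p r.
Proof.
have ge_g u v : meet u v <= gromov (val u).1 (val v).1.
  by rewrite /meet !ge_min lexx !orbT.
have [->|[->|->]] : meet p r = (val p).2 \/ meet p r = (val r).2 \/
    meet p r = gromov (val p).1 (val r).1.
- by rewrite /meet; case_min; auto.
- by left; exact: meet_lel.
- by right; exact: meet_ler.
have [le|le] := gromov_ultra (val p).1 (val q).1 (val r).1.
- by left; apply: le_trans le.
- by right; apply: le_trans le.
Qed.

Lemma pdistxx p : pdist p p = 0.
Proof. by rewrite /pdist meetxx; ring. Qed.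

Lemma pdistC p q : pdist p q = pdist q p.
Proof. by rewrite /pdist meetC; ring. Qed.

Lemma pdist_ge0 p q : 0 <= pdist p q.
Proof. have := meet_lel p q; have := meet_ler p q; rewrite /pdist; lra. Qed.

Lemma pdist_triangle q p r : pdist p r <= pdist p q + pdist q r.
Proof.
have := meet_ultra p q r; have := meet_ler p q; have := meet_lel q r.
by rewrite /pdist; lra.
Qed.

Lemma pdist4 p q r s : pdist p q + pdist r s <= pdist p r + pdist q s \/
                       pdist p q + pdist r s <= pdist p s + pdist q r.
Proof.
rewrite /pdist.
(* Of the twelve ultrametric inequalities among four points, these four
   suffice. *)
have [] := meet_ultra p r q; have [] := meet_ultra p s q;
have [] := meet_ultra r p s; have [] := meet_ultra r q s;
rewrite ?(meetC r p) ?(meetC r q) ?(meetC s q); lra.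
Qed.

(** Segments that share an initial part give several pairs for one point. *)
Definition coincide (p q : point) := pdist p q == 0.

Lemma coincide_refl : reflexive coincide.
Proof. by move=> p; rewrite /coincide pdistxx. Qed.

Lemma coincide_sym : symmetric coincide.
Proof. by move=> p q; rewrite /coincide pdistC. Qed.

Lemma coincide_trans : transitive coincide.
Proof.
move=> q p r /eqP pq /eqP qr; rewrite /coincide eq_le pdist_ge0 andbT.
by have := pdist_triangle q p r; rewrite pq qr addr0.
Qed.

Canonical coincide_rel :=
  EquivRel coincide coincide_refl coincide_sym coincide_trans.

Definition tree_space := {eq_quot coincide}%qT.
HB.instance Definition _ := Choice.on tree_space.
HB.instance Definition _ := EqQuotient.on tree_space.

Definition tspace_dist (x y : tree_space) : R := pdist (repr x) (repr y).

Lemma tspace_dist_pi p q :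
  tspace_dist (\pi_tree_space p)%qT (\pi_tree_space q)%qT = pdist p q.
Proof.
have rE p' : pdist (repr (\pi_tree_space p')%qT) p' = 0.
  by apply/eqP; apply/(@eqquotP _ coincide_rel tree_space); rewrite reprK.
rewrite /tspace_dist; set p' := repr _; set q' := repr _.
have := rE p; have := rE q; rewrite -/p' -/q' => q0 p0.
have := pdist_triangle p p' q'; have := pdist_triangle q p q'.
have := pdist_triangle p' p q; have := pdist_triangle q' p' q.
by rewrite (pdistC p p') (pdistC q q'); lra.
Qed.

Lemma tspace_distxx x : tspace_dist x x = 0.
Proof. exact: pdistxx. Qed.

Lemma tspace_dist_eq0 x y : tspace_dist x y = 0 -> x = y.
Proof.
rewrite -[x]reprK -[y]reprK tspace_dist_pi => /eqP xy.
exact/(@eqquotP _ coincide_rel tree_space).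
Qed.

Lemma tspace_distC x y : tspace_dist x y = tspace_dist y x.
Proof. exact: pdistC. Qed.

Lemma tspace_triangle y x z :
  tspace_dist x z <= tspace_dist x y + tspace_dist y z.
Proof. exact: pdist_triangle. Qed.

HB.instance Definition _ := isMetric.Build R tree_space tspace_distxx
  tspace_dist_eq0 tspace_distC tspace_triangle.

Lemma mdist_pi p q :
  mdist (\pi_tree_space p)%qT (\pi_tree_space q)%qT = pdist p q.
Proof. exact: tspace_dist_pi. Qed.

End PointedTree.

(** * Geodesics and slim triangles *)

Lemma min_common_bound (R : realFieldType) (a b l : R) : a <= l -> b <= l ->
  a + b - 2 * Num.min a (Num.min b l) = `|a - b|.
Proof.
move=> al bl; rewrite (min_l bl).
by case: (leP a b) => ab; [rewrite ler0_norm|rewrite gtr0_norm]; lra.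
Qed.

Lemma min3_squeeze (R : realFieldType) (t s l a b : R) :
  Num.min t (Num.min s l) <= a <= t -> Num.min t (Num.min s l) <= b <= s ->
  Num.min a (Num.min b l) = Num.min t (Num.min s l).
Proof.
set m := Num.min t _ => /andP[ma at_] /andP[mb bs].
apply/eqP; rewrite eq_le; apply/andP; split.
  by rewrite /m !le_min !ge_min at_ bs lexx !orbT.
by rewrite !le_min ma mb /m !ge_min lexx !orbT.
Qed.

(** The change of base point in a tree. Here H = |h|, a = |g|, b = |g'|,
    A = |hg|, B = |hg'| and c = d(g, g'); the points at distance t and s from h
    on the segments from h to hg and to hg' are rewritten with respect to the
    base point, and their distance is unchanged. A point
    close to h lies on the segment from the base point to h, a point beyond the
    branching lies on the segment to hg (or hg'); the booleans record which,
    and [overlap] is the Gromov product of the chosen ends. *)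
Lemma reroot_isometry (R : realFieldType) (H a b A B c t s : R) :
  H + c <= A + b \/ H + c <= B + a ->
  A + b <= H + c \/ A + b <= B + a ->
  B + a <= H + c \/ B + a <= A + b ->
  a <= H + A -> b <= H + B -> A <= H + a -> B <= H + b -> c <= a + b ->
  a <= b + c -> b <= a + c -> 0 <= t <= a -> 0 <= s <= b ->
  let p := if t <= (H + a - A) / 2 then (H - t, true) else (A - a + t, false) in
  let q := if s <= (H + b - B) / 2 then (H - s, true) else (B - b + s, false) in
  let overlap := if p.2 then if q.2 then H else (H + B - b) / 2
                 else if q.2 then (H + A - a) / 2 else (A + B - c) / 2 in
  p.1 + q.1 - 2 * Num.min p.1 (Num.min q.1 overlap) =
  t + s - 2 * Num.min t (Num.min s ((a + b - c) / 2)).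
Proof.
move=> h1 h2 h3 t1 t2 t3 t4 t5 t6 t7 ta sb.
case: (leP t) => ht; case: (leP s) => hs; case_min; lra.
Qed.

Section TreeAction.
Variables (R : realType) (G : groupType) (L : tree_length G).

Local Notation "'ell' g" := ((L g)%:R : R) (at level 10).
Local Notation d g h := ((tdist L g h)%:R : R).
Local Notation gp := (@gromov R G L).
Local Notation point := (point R L).
Local Notation X := (tree_space R L).

(** Clamping makes [mkpoint] total, so that no proof of the bounds has to be
    carried around. *)
Definition clamp (g : G) (t : R) : R := Num.max 0 (Num.min t (ell g)).

Lemma clamp_bounds g t : 0 <= clamp g t <= ell g.
Proof.
have := ler0n R (L g); rewrite /clamp maxEle; case_min => ?; case: ifP; lra.
Qed.

Definition mkpoint (g : G) (t : R) : point :=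
  exist (fun p : G * R => 0 <= p.2 <= ell p.1) (g, clamp g t) (clamp_bounds g t).

Lemma clampK g t : 0 <= t <= ell g -> clamp g t = t.
Proof.
by rewrite /clamp => /andP[t0 tg]; rewrite min_l// max_r.
Qed.

Lemma mkpointK (p : point) : mkpoint (val p).1 (val p).2 = p.
Proof.
by apply: val_inj; case: p => -[g t] gt /=; rewrite clampK.
Qed.

Lemma pdist_mk g t h s : 0 <= t <= ell g -> 0 <= s <= ell h ->
  pdist (mkpoint g t) (mkpoint h s) =
    t + s - 2 * Num.min t (Num.min s (gp g h)).
Proof. by move=> tg sh; rewrite /pdist /meet /= !clampK. Qed.

Definition cls (p : point) : X := (\pi_X p)%qT.

Lemma mdist_cls p q : mdist (cls p) (cls q) = pdist p q.
Proof. exact: mdist_pi. Qed.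

Lemma clsK (x : X) : cls (repr x) = x.
Proof. exact: reprK. Qed.

Lemma mdist4 (x y z w : X) :
  mdist x y + mdist z w <= mdist x z + mdist y w \/
  mdist x y + mdist z w <= mdist x w + mdist y z.
Proof. exact: pdist4. Qed.

(** Down from x to the branching point of height m, then up to y. *)
Lemma tree_geodesic (x y : X) : exists c, geodesic x y c.
Proof.
rewrite -(clsK x) -(clsK y); move: (repr x) (repr y) => p q.
have pE := mkpointK p; have qE := mkpointK q.
have := height_ge0 p; have := height_le p; have := height_ge0 q.
have := height_le q.
move: pE qE; case: (val p) => g t; case: (val q) => h s /= <- <- sh s0 tg t0.
pose m := Num.min t (Num.min s (gp g h)).
have mg := gromov_ge0 R L g h.
have D : mdist (cls (mkpoint g t)) (cls (mkpoint h s)) = t + s - 2 * m.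
  by rewrite mdist_cls pdist_mk ?t0 ?s0.
have m0 : 0 <= m by rewrite /m; case_min; lra.
have mt : m <= t by rewrite /m; case_min; lra.
have ms : m <= s by rewrite /m; case_min; lra.
exists (fun u => if u <= t - m then cls (mkpoint g (t - u))
          else cls (mkpoint h (2 * m + u - t))); split.
- by rewrite subr_ge0 mt subr0.
- rewrite D; case: leP => [le|_].
    apply: mdist_positivity; rewrite mdist_cls pdist_mk; try lra.
    by move: le; rewrite /m; case_min; lra.
  by congr (cls (mkpoint _ _)); ring.
- move=> u v; rewrite D.
  wlog uv : u v / u <= v => [H uD vD|uD vD].
    case: (leP u v) => [/H|/ltW/H]; first exact.
    by rewrite metric_sym distrC; apply.
  case: (leP u) => ut; case: (leP v) => vt; rewrite mdist_cls pdist_mk ?gromovxx;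
    try lra.
  + have -> : `|u - v| = `|(t - u) - (t - v)| by rewrite distrC; congr (`|_|); ring.
    by apply: min_common_bound; lra.
  + by rewrite (@min3_squeeze _ t s) -/m ?ler0_norm; lra.
  + have -> : `|u - v| = `|(2 * m + u - t) - (2 * m + v - t)|.
      by congr (`|_|); ring.
    by apply: min_common_bound; lra.
Qed.

(** A point of a tree is determined by its distances to the ends of a segment
    on which it lies. *)
Lemma between_unique (x y z w : X) :
  mdist x z + mdist z y = mdist x y -> mdist x w = mdist x z ->
  mdist w y = mdist z y -> z = w.
Proof.
move=> xzy xw wy; apply: mdist_positivity; apply/eqP.
rewrite eq_le mdist_ge0 andbT.
by have := mdist4 z w x y; rewrite !(metric_sym z x) !(metric_sym w x); lra.
Qed.

Lemma geodesic_through (x y z : X) (c : R -> X) : geodesic x y c ->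
  mdist x z + mdist z y = mdist x y ->
  0 <= mdist x z <= mdist x y /\ c (mdist x z) = z.
Proof.
move=> [c0 c1 cd] xzy; have xz0 := mdist_ge0 x z; have zy0 := mdist_ge0 z y.
have b : 0 <= mdist x z <= mdist x y by lra.
have xc : mdist x (c (mdist x z)) = mdist x z.
  by rewrite -{1}c0 cd// ?lexx ?sub0r ?normrN ?ger0_norm//; lra.
split=> //; apply/esym/(between_unique xzy xc).
by rewrite -{1}c1 cd// ?ler0_norm; lra.
Qed.

Lemma geodesic_between (x y : X) (c : R -> X) s : geodesic x y c ->
  0 <= s <= mdist x y -> mdist x (c s) = s /\ mdist (c s) y = mdist x y - s.
Proof.
move=> [c0 c1 cd] sxy; split.
  by rewrite -{1}c0 cd// ?sub0r ?normrN ?ger0_norm; lra.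
by rewrite -{1}c1 cd// ?ler0_norm; lra.
Qed.

(** By the four-point condition, a point between x and y is between y and z or
    between x and z, hence on the corresponding side. *)
Lemma tree_slim : @slim_triangles R X 0.
Proof.
move=> x y z p q r gp gq gr s sxy.
have [xp py] := geodesic_between gp sxy.
have [h|h] := mdist4 (p s) z x y.
- left; have yqz : mdist y (p s) + mdist (p s) z = mdist y z.
    have := metric_triangle y (p s) z.
    by move: h; rewrite (metric_sym (p s) x) (metric_sym z y) (metric_sym y (p s)); lra.
  have [t qt] := geodesic_through gq yqz.
  by exists (mdist y (p s)) => //; rewrite qt mdistxx.
- right; have xqz : mdist x (p s) + mdist (p s) z = mdist x z.
    have := metric_triangle x (p s) z.
    by move: h; rewrite (metric_sym z x); lra.
  have [t qt] := geodesic_through gr xqz.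
  by exists (mdist x (p s)) => //; rewrite qt mdistxx.
Qed.

Lemma tree_hyperbolic : hyperbolic_space X.
Proof. by split; [exact: tree_geodesic|exists 0 => //; exact: tree_slim]. Qed.

Definition vertex (g : G) : X := cls (mkpoint g (ell g)).

Lemma ell_bounds g : 0 <= ell g <= ell g.
Proof. by rewrite ler0n lexx. Qed.

Lemma mdist_vertex g h : mdist (vertex g) (vertex h) = d g h.
Proof.
rewrite mdist_cls pdist_mk ?ell_bounds// min_r ?le_min ?gromov_lel ?lexx ?andbT.
  by rewrite min_r ?gromov_ler// tdistE.
by rewrite ge_min gromov_lel orbT.
Qed.

Lemma mdist_base g t : 0 <= t <= ell g ->
  mdist (vertex 1%g) (cls (mkpoint g t)) = t.
Proof.
move=> tg; have := gromov_ge0 R L 1%g g; have := gromov_lel R L 1%g g.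
rewrite mdist_cls pdist_mk ?ell_bounds// tlen1; case_min; lra.
Qed.

Lemma mdist_tip g t : 0 <= t <= ell g ->
  mdist (cls (mkpoint g t)) (vertex g) = ell g - t.
Proof.
move=> tg; rewrite mdist_cls pdist_mk ?ell_bounds// gromovxx; case_min; lra.
Qed.

(** * The action on the tree *)

(** The point at distance t from h on the segment from h to hg, in coordinates
    with respect to the base point; at the branching point both cases describe
    the same point of the tree. *)
Definition act_point (h : G) (p : point) : point :=
  let: (g, t) := val p in
  if t <= gp h^-1%g g then mkpoint h (ell h - t)
  else mkpoint (h * g)%g (ell (h * g)%g - ell g + t).

Lemma tdist_inv h g : d h^-1%g g = ell (h * g)%g.
Proof. by rewrite /tdist invgK. Qed.

Lemma act_point_isometry h p q :
  pdist (act_point h p) (act_point h q) = pdist p q.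
Proof.
rewrite -(mkpointK p) -(mkpointK q).
have := height_ge0 p; have := height_le p; have := height_ge0 q.
have := height_le q.
case: (val p) => g t; case: (val q) => g' t' /= => t'g t'0 tg t0.
rewrite pdist_mk ?t0 ?t'0// /act_point /= !clampK ?t0 ?t'0//.
have dh k : d h (h * k)%g = ell k by rewrite tdistMr.
have := @reroot_isometry R (ell h) (ell g) (ell g') (ell (h * g)%g)
  (ell (h * g')%g) (d g g') t t'.
have := tdist4R R L 1%g h (h * g)%g (h * g')%g.
have := tdist4R R L 1%g (h * g)%g h (h * g')%g.
have := tdist4R R L 1%g (h * g')%g h (h * g)%g.
have := tdist_triangleR R L h 1%g (h * g)%g.
have := tdist_triangleR R L h 1%g (h * g')%g.
have := tdist_triangleR R L 1%g h (h * g)%g.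
have := tdist_triangleR R L 1%g h (h * g')%g.
have := tdist_triangleR R L g 1%g g'.
have := tdist_triangleR R L 1%g g g'.
have := tdist_triangleR R L 1%g g' g.
rewrite (tdistC _ (h * g')%g (h * g)%g) !(tdistC _ (h * g)%g h).
rewrite !(tdistC _ (h * g')%g h) (tdistC _ g' g) !tdistM !tdist1g !tdistg1 !dh.
move=> c1 c2 c3 c4 c5 c6 c7 q1 q2 q3 /=.
have gE k : gp h^-1%g k = (ell h + ell k - ell (h * k)%g) / 2.
  by rewrite /gromov tlenV tdist_inv.
rewrite !gE.
do 10?[move=> /(_ ltac:(lra))]; rewrite t0 tg t'0 t'g => /(_ isT isT).
have gE2 k : gp h (h * k)%g = (ell h + ell (h * k)%g - ell k) / 2.
  by rewrite /gromov dh.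
have gE3 : gp (h * g)%g (h * g')%g =
    (ell (h * g)%g + ell (h * g')%g - d g g') / 2.
  by rewrite /gromov tdistM.
have gE4 : gp g g' = (ell g + ell g' - d g g') / 2 by [].
rewrite -gE4.
case: leP => lt; case: leP => ls /= <-; rewrite pdist_mk ?gromovxx ?gE2 ?gE3;
  rewrite ?(gromovC R L (h * g)%g h) ?gE2 //; lra.
Qed.

Lemma act_point_cls h p q : cls p = cls q ->
  cls (act_point h p) = cls (act_point h q).
Proof.
move=> pq; apply: mdist_positivity.
by rewrite mdist_cls act_point_isometry -mdist_cls pq mdistxx.
Qed.

Definition tree_act (h : G) (x : X) : X := cls (act_point h (repr x)).

Lemma tree_act_cls h p : tree_act h (cls p) = cls (act_point h p).
Proof. by apply: act_point_cls; rewrite clsK. Qed.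

Lemma tree_act_isometry h x y :
  mdist (tree_act h x) (tree_act h y) = mdist x y.
Proof. by rewrite mdist_cls act_point_isometry -mdist_cls !clsK. Qed.

Lemma tree_act_vertex h g : tree_act h (vertex g) = vertex (h * g)%g.
Proof.
rewrite tree_act_cls /act_point /= clampK ?ell_bounds//.
case: leP => [le|_]; last by rewrite /vertex; congr (cls (mkpoint _ _)); ring.
have E : ell (h * g)%g = ell h - ell g.
  have := tdist_triangleR R L h (h * g)%g 1%g.
  rewrite tdistMr !tdistg1.
  by move: le; rewrite /gromov tlenV tdist_inv; lra.
have b : 0 <= ell h - ell g <= ell h.
  have := ler0n R (L g); have := ler0n R (L (h * g)%g); lra.
apply: mdist_positivity; rewrite mdist_cls pdist_mk ?ell_bounds//.
rewrite /gromov tdistMr -E min_r; last by rewrite ge_min lexx.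
by rewrite min_l; lra.
Qed.

Lemma tree_act1 x : tree_act 1%g x = x.
Proof.
rewrite -[x]clsK tree_act_cls /act_point; move: (repr x) => p.
rewrite -[in RHS](mkpointK p).
have := height_ge0 p; have := height_le p; case: (val p) => g t /= tg t0.
case: leP => [le|_]; last first.
  by rewrite mul1g; congr (cls (mkpoint _ _)); ring.
have := gromov_lel R L 1^-1%g g; rewrite tlenV tlen1 => ?.
apply: mdist_positivity; rewrite mdist_cls pdist_mk ?tlen1.
- have := gromov_ge0 R L 1%g g; case_min; lra.
- lra.
- lra.
Qed.

(** Both sides are the point at distance t from hk on the segment from hk to
    hkg, which is unique. *)
Lemma tree_actM h k x : tree_act (h * k)%g x = tree_act h (tree_act k x).
Proof.
rewrite -[x]clsK; have := mkpointK (repr x).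
have := height_ge0 (repr x); have := height_le (repr x).
case: (val (repr x)) => g t /= tg t0 <-.
have b : 0 <= t <= ell g by lra.
have ends l : mdist (vertex l) (tree_act l (cls (mkpoint g t))) = t /\
    mdist (tree_act l (cls (mkpoint g t))) (vertex (l * g)%g) = ell g - t.
  rewrite -{1}[l]mulg1 -!tree_act_vertex !tree_act_isometry.
  by rewrite mdist_base// mdist_tip.
have [h1 h2] := ends (h * k)%g; have [k1 k2] := ends k.
apply: (@between_unique (vertex (h * k)%g) (vertex (h * k * g)%g)).
- by rewrite h1 h2 mdist_vertex tdistMr; ring.
- by rewrite h1 -tree_act_vertex tree_act_isometry k1.
- by rewrite h2 -mulgA -tree_act_vertex tree_act_isometry k2.
Qed.

Lemma tree_isometric_action : isometric_action tree_act.
Proof.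
split; [exact: tree_act1|exact: tree_actM|exact: tree_act_isometry].
Qed.

(** Rounding t down gives a prefix of g within distance 1. *)
Lemma near_vertex (x : X) : exists g, mdist x (vertex g) <= 1.
Proof.
rewrite -[x]clsK; have := mkpointK (repr x).
have := height_ge0 (repr x); have := height_le (repr x).
case: (val (repr x)) => g t /= tg t0 <-.
have [n1 n2] : (Num.trunc t)%:R <= t /\ t < (Num.trunc t).+1%:R.
  by apply/andP; exact: truncn_itv.
set n := Num.trunc t in n1 n2.
have ng : (n <= L g)%N by rewrite -(ler_nat R); lra.
have [h Lh hg] := tlen_prefix ng.
exists h; rewrite mdist_cls pdist_mk ?ell_bounds//; last by lra.
have -> : gp g h = ell h.
  by rewrite /gromov tdistC /tdist hg Lh natrB//; field.
by rewrite Lh minxx min_r//; move: n2; rewrite -natr1; lra.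
Qed.

(** Replacing the two points by nearby vertices u and v costs 2 in the
    displacement; conjugating by u moves u to the base point. *)
Lemma tree_acylindrical : small_stabilizers L -> acylindrical tree_act.
Proof.
move=> stab r r0; pose D := (Num.trunc (r + 2)).+1.
have rD : r + 2 < D%:R by have /andP[] := truncn_itv (ltac:(lra) : 0 <= r + 2).
have [M [N MN]] := discrete_acylindrical stab D.
exists (M%:R + 2), N; split; first by rewrite addr_ge0.
move=> x y xy; have [u xu] := near_vertex x; have [v yv] := near_vertex y.
have close w z g : mdist w (vertex z) <= 1 -> mdist w (tree_act g w) <= r ->
    (tdist L z (g * z)%g <= D)%N.
  move=> wz wg; rewrite -(ler_nat R) -mdist_vertex -tree_act_vertex ltW//.
  have t1 := metric_triangle (vertex z) w (tree_act g (vertex z)).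
  have t2 := metric_triangle w (tree_act g w) (tree_act g (vertex z)).
  move: t2; rewrite tree_act_isometry => t2.
  by move: t1; rewrite (metric_sym _ w); lra.
have uv : (M <= L (u^-1 * v)%g)%N.
  rewrite -/(tdist L u v) -(ler_nat R) -mdist_vertex.
  have t1 := metric_triangle x (vertex u) y.
  have t2 := metric_triangle (vertex u) (vertex v) y.
  by move: t1 t2; rewrite (metric_sym (vertex v) y); lra.
have [key [keyN key_inj]] := MN _ uv.
have memP g : mdist x (tree_act g x) <= r -> mdist y (tree_act g y) <= r ->
   (g ^ u)%g \in [pred h | (L h <= D)%N &&
     (tdist L (u^-1 * v) (h * (u^-1 * v)) <= D)%N].
  move=> gx gy; rewrite inE conjgE; have := close _ _ _ xu gx.
  have := close _ _ _ yv gy; rewrite /tdist => cv cu; rewrite cu /=.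
  by rewrite !(invgM, invgK, mulgA, mulgK, mulgVK) in cv *.
apply/pcard_leP; apply/injfunPex; exists (fun g => key (g ^ u)%g).
  by move=> g [gx gy] /=; apply: keyN; exact: memP.
move=> g g'; rewrite !inE => -[gx gy] [g'x g'y] /key_inj H.
by apply: (conjg_inj u); apply: H; exact: memP.
Qed.

End TreeAction.

(** * Distances in Cayley graphs *)

Section CayleyDistance.
Variables (R : realType) (G : groupType) (S : {fset G}).
Local Notation edge := (cayley_edge S).
Local Notation dist g h := (cay_dist (cay_vertex R S g) (cay_vertex R S h)).

Definition reach (n : nat) (g h : G) :=
  exists p, [/\ path edge g p, last g p = h & (size p <= n)%N].

Lemma reach_refl n g : reach n g g.
Proof. by exists [::]. Qed.

Lemma reach_trans m n g h k :
  reach m g h -> reach n h k -> reach (m + n) g k.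
Proof.
move=> [p [pp pl ps]] [q [qp ql qs]]; exists (p ++ q).
by rewrite cat_path last_cat pp pl qp size_cat leq_add.
Qed.

Lemma edge_sym g h : edge g h = edge h g.
Proof. by rewrite /cayley_edge eq_sym orbC. Qed.

Lemma edgeM x g h : edge (x * g)%g (x * h)%g = edge g h.
Proof.
by rewrite /cayley_edge (inj_eq (mulgI x)) !invgM -!mulgA !mulKg.
Qed.

Lemma reach_sym n g h : reach n g h -> reach n h g.
Proof.
move=> [p [pp pl ps]]; exists (rev (belast g p)).
rewrite -pl rev_path size_rev size_belast; split => //.
  by under eq_path do rewrite edge_sym.
by case: p {pp pl ps} => //= q p; rewrite rev_cons last_rcons.
Qed.

Lemma reachM x n g h : reach n g h -> reach n (x * g)%g (x * h)%g.
Proof.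
move=> [p [pp pl ps]]; exists (map (fun k => x * k)%g p).
rewrite last_map pl size_map; split => //.
by rewrite path_map; under eq_path do rewrite /= edgeM.
Qed.

Definition short n g := reach n 1%g g.

Lemma short1 n : short n 1%g.
Proof. exact: reach_refl. Qed.

Lemma reach_short n g h : reach n g h <-> short n (g^-1 * h)%g.
Proof.
split=> [/(reachM g^-1%g)|/(reachM g)]; first by rewrite mulVg.
by rewrite mulg1 mulVKg.
Qed.

Lemma shortM m n g h : short m g -> short n h -> short (m + n) (g * h)%g.
Proof. by move=> sg /(reachM g); rewrite mulg1; exact: reach_trans. Qed.

Lemma shortV n g : short n g -> short n g^-1%g.
Proof. by move=> /(reachM g^-1%g)/reach_sym; rewrite mulg1 mulVg. Qed.

Lemma shortX n k g : short n g -> short (k * n) (g ^+ k)%g.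
Proof.
by move=> sg; elim: k => [|k IH]; [exact: short1|rewrite expgS mulSn; exact: shortM].
Qed.

Lemma short_gen g : g \in S -> short 1 g.
Proof.
move=> gS; case: (eqVneq 1%g g) => [<-|g1]; first exact: short1.
by exists [:: g]; rewrite /= /cayley_edge g1 invg1 mul1g gS.
Qed.

Lemma generates_short : generates S -> forall g, exists n, short n g.
Proof.
move=> gen g; pose P : {pred G} := fun g => `[< exists n, short n g >].
have PP h : reflect (exists n, short n h) (h \in P) by exact: asboolP.
apply/PP/gen => [|s sS]; last by apply/PP; exists 1%N; exact: short_gen.
split=> [|u v /PP[m su] /PP[n sv]]; apply/PP.
  by exists 0%N; exact: short1.
by exists (m + n)%N; apply: shortM => //; exact: shortV.
Qed.

Lemma cay_distE g h :
  dist g h = inf [set (size p)%:R | p in [set p | path edge g p /\ last g p = h]].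
Proof.
rewrite /cay_dist /path_dist setU0 /vertex_path_lengths /=.
rewrite -[RHS](inf1 (vertex_dist R edge g h)); congr inf.
apply/seteqP; split=> l /=.
  by move=> [a [b []]]; rewrite !inE => /eqP -> /eqP -> ->; rewrite add0r addr0.
by move=> ->; exists (g, 0), (h, 0); rewrite !inE !eqxx add0r addr0; split.
Qed.

Lemma cay_dist_le n g h : reach n g h -> dist g h <= n%:R.
Proof.
move=> [p [pp pl pn]]; rewrite cay_distE; apply: (@le_trans _ _ (size p)%:R).
  apply: ge_inf; last by exists p.
  by exists 0 => _ [q _ <-].
by rewrite ler_nat.
Qed.

(** A lower bound for the distance from a pseudometric f that no generator
    increases by more than K. *)
Lemma cay_dist_ge (f : G -> G -> nat) (K n : nat) : generates S ->
  (forall g, f g g = 0%N) -> (forall g h k, f g k <= f g h + f h k)%N ->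
  (forall s, s \in S -> forall g, f g (g * s)%g <= K /\ f (g * s)%g g <= K)%N ->
  forall g h, (K * n <= f g h)%N -> (0 < K)%N -> n%:R <= dist g h.
Proof.
move=> gen f0 ftri fS g h nf K0; rewrite cay_distE; apply: lb_le_inf.
  have [m sm] := generates_short gen (g^-1 * h)%g.
  have [p [pp pl _]] := (reach_short m g h).2 sm.
  by exists (size p)%:R; exists p.
move=> _ [p [pp pl] <-]; rewrite ler_nat -(leq_pmul2l K0); apply: leq_trans nf _.
rewrite -pl; elim: p g {pl} pp => [|k p IH] g /=; first by rewrite f0.
move=> /andP[/andP[_ gk] /IH le]; have := ftri g k (last k p).
have : (f g k <= K)%N.
  case/orP: gk => /fS; first by move=> /(_ g); rewrite mulVKg => -[].
  by move=> /(_ k); rewrite mulVKg => -[].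
by move: le; rewrite mulnS; lia.
Qed.

End CayleyDistance.

(** The alternative avoids a case split on the order of m and n, both outcomes
    having the same length. *)
Lemma zpow_quotient (G : groupType) (g : G) (m n : int) :
  ((zpow g m)^-1 * zpow g n = g ^+ `|(m - n)%R|)%g \/
  ((zpow g m)^-1 * zpow g n = g ^- `|(m - n)%R|)%g.
Proof.
have sub p q : (g ^- p * g ^+ q = g ^+ `|p%:Z - q%:Z|)%g \/
               (g ^- p * g ^+ q = g ^- `|p%:Z - q%:Z|)%g.
  case: (leqP p q) => [pq|/ltnW pq]; [left|right].
    by rewrite -{1}(subnKC pq) expgnDr mulKg; congr (_ ^+ _)%g; lia.
  rewrite -{1}(subnKC pq) expgnDr invgM mulgVK; congr (_ ^- _)%g; lia.
case: m => p; case: n => q /=.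
- exact: sub.
- right; rewrite -invgM -expgnDr; congr (_ ^- _)%g; lia.
- left; rewrite invgK -expgnDr; congr (_ ^+ _)%g; lia.
- rewrite invgK; have C : commute (g ^+ p.+1)%g (g ^- q.+1)%g.
    by apply: commuteV; rewrite /commute -!expgnDr addnC.
  rewrite C; have [->|->] := sub q.+1 p.+1; 
    [left; congr (_ ^+ _)%g|right; congr (_ ^- _)%g]; lia.
Qed.

Lemma zpow_nat (G : groupType) (g : G) (n : nat) : zpow g n = (g ^+ n)%g.
Proof. by []. Qed.

(** * Short conjugates of the axis prevent contraction *)

Section SlowContraction.
Variables (R : realType) (G : groupType) (S : {fset G}) (a c : G).
Variables (f : G -> int).
Hypotheses (gen : generates S) (cS : c \in S).
Hypotheses (fM : forall g h, f (g * h)%g = (f g + f h)%R)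
  (fS : forall s, s \in S -> (`|f s| <= 1)%N) (fa : f a = 0) (fc : f c = 1).
Local Notation dist g h := (cay_dist (cay_vertex R S g) (cay_vertex R S h)).
Local Notation axis := [set cay_vertex R S (zpow a n) | n in [set: int]].

Let f1 : f 1%g = 0.
Proof. by have := fM 1%g 1%g; rewrite mulg1; lia. Qed.

Let fX g n : f (g ^+ n)%g = f g *+ n.
Proof. by elim: n => [|n IH]; rewrite ?mulr0n// expgS fM IH mulrS. Qed.

Let fV g : f g^-1%g = - f g.
Proof. by have := fM g g^-1%g; rewrite mulgV f1; lia. Qed.

Let f_axis n : f (zpow a n) = 0.
Proof. by case: n => n; rewrite /= ?fV fX fa mul0rn ?oppr0. Qed.

Let height_dist g h n : (n <= `|f g - f h|)%N -> n%:R <= dist g h.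
Proof.
move=> nf; apply: (@cay_dist_ge R G S (fun g h => `|f g - f h|%N) 1) => //.
- by move=> k; rewrite subrr.
- by move=> k l o; lia.
- by move=> s /fS fs k; rewrite fM; lia.
- by rewrite mul1n.
Qed.

(* f is 0 on the axis and m at a^k c^m, and changes by at most 1 along an edge. *)
Let coset_dist k m : dist (a ^+ k * c ^+ m)%g (a ^+ k)%g = m%:R /\
  dist_to (@cay_dist R G S) axis (cay_vertex R S (a ^+ k * c ^+ m)%g) = m%:R.
Proof.
have lb n : m%:R <= dist (a ^+ k * c ^+ m)%g (zpow a n).
  apply: height_dist; rewrite f_axis subr0 fM !fX fa fc mul0rn add0r; lia.
have E : dist (a ^+ k * c ^+ m)%g (a ^+ k)%g = m%:R.
  apply/eqP; rewrite eq_le (lb k) andbT; apply/cay_dist_le/reach_sym/reach_short.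
  by rewrite mulKg -{1}[m]muln1; apply: shortX; exact: short_gen.
split=> //; apply/eqP; rewrite eq_le; apply/andP; split.
  rewrite -[leRHS]E; apply: ge_inf; first by exists m%:R => _ [_ [n _ <-] <-].
  by exists (cay_vertex R S (zpow a k)) => //; exists (k : int).
apply: lb_le_inf; last by move=> _ [_ [n _ <-] <-].
by exists (dist (a ^+ k * c ^+ m)%g 1%g); exists (cay_vertex R S 1%g) => //; exists 0.
Qed.

(** The points c^m and a^k c^m both have distance m to the axis, they are
    at distance at most k l, and their projections contain 1 and a^k. *)
Lemma slow_contraction (rho : R -> R) m l k : short S l (a ^ (c ^+ m))%g ->
  (k * l <= m)%N -> k%:R <= dist 1%g (a ^+ k)%g ->
  contracting (@cay_dist R G S) rho axis -> k%:R <= rho m%:R.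
Proof.
move=> sh klm kd ctr.
have [d0 D0] := coset_dist 0 m; have [dk Dk] := coset_dist k m.
rewrite expg0 mul1g in d0 D0.
have xz : dist (c ^+ m)%g (a ^+ k * c ^+ m)%g <= m%:R.
  apply/cay_dist_le/reach_short; rewrite mulgA -mulgA -conjgE conjXg.
  have [p [pp pl ps]] := shortX k sh.
  by exists p; split => //; exact: leq_trans klm.
have := ctr (cay_vertex R S (c ^+ m)%g) (cay_vertex R S (a ^+ k * c ^+ m)%g).
rewrite D0 => /(_ xz) diamle; rewrite -lee_fin; apply: le_trans diamle.
apply: (@le_trans _ _ (dist 1%g (a ^+ k)%g)%:E); first by rewrite lee_fin.
apply: ereal_sup_ubound; exists (cay_vertex R S 1%g, cay_vertex R S (a ^+ k)%g) => //=.
split; [left|right]; split; rewrite ?D0 ?Dk ?d0 ?dk//.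
- by exists 0.
- by exists (k : int).
Qed.

End SlowContraction.

Lemma linear_le_exp2 j : (5 <= j)%N -> (4 * j + 5 <= 2 ^ j)%N.
Proof.
elim: j => // j IH; rewrite ltnS leq_eqVlt => /orP[/eqP <-//|/IH].
by rewrite expnS; lia.
Qed.

(** For r between 2^j and 2^(j+1), put k = 2^j / (4j + 5), rounded down.
    Then r <= 20 k j, while rho(r) >= k and ln r >= j ln 2; hence
    rho(r) ln r / r is bounded below by ln 2 / 20. *)
Lemma gauge_lower_bound (R : realType) (rho : R -> R) :
  contraction_gauge rho ->
  (forall j, ((2 ^ j) %/ (4 * j + 5))%:R <= rho (2 ^ j)%:R) ->
  limf_einf (fun r : R => (rho r * ln r / r)%:E) +oo <> 0%E.
Proof.
move=> [rho0 rho_mono _] rhoj; have ln2 : 0 < ln 2 :> R by rewrite ln_gt0// ltr1n.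
suff : ((ln 2 / 20)%:E <= limf_einf (fun r : R => (rho r * ln r / r)%:E) (+oo)%R)%E.
  by move=> le E; move: le; rewrite E lee_fin leNgt divr_gt0.
rewrite limf_einfE; apply: ereal_sup_ge.
(* 64 = 2^6 ensures j >= 6, so that 4j + 5 <= 5j and k >= 1. *)
exists (ereal_inf [set (rho r * ln r / r)%:E | r in [set r : R | 64 < r]]).
  by exists [set r : R | 64 < r] => //; exists 64; split.
apply: le_ereal_inf_tmp => _ [r /= r64 <-]; rewrite lee_fin.
have r0 : 0 < r by lra.
have /andP[n1 n2] : (Num.trunc r)%:R <= r < (Num.trunc r).+1%:R.
  by apply: truncn_itv; lra.
set n := Num.trunc r in n1 n2.
have n64 : (64 <= n)%N by rewrite -ltnS -(ltr_nat R); lra.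
have /andP[j1 j2] : (2 ^ trunc_log 2 n <= n < 2 ^ (trunc_log 2 n).+1)%N.
  by apply: trunc_log_bounds => //; lia.
set j := trunc_log 2 n in j1 j2.
have j6 : (6 <= j)%N by rewrite -ltnS -(ltn_exp2l _ _ (isT : 1 < 2)%N); lia.
set k := ((2 ^ j) %/ (4 * j + 5))%N.
have jr : (2 ^ j)%:R <= r by apply: le_trans n1; rewrite ler_nat.
have rj : r < (2 ^ j)%:R * 2.
  by apply: lt_le_trans n2 _; rewrite -natrM ler_nat -expnSr.
have kj : (2 ^ j <= 10 * (k * j))%N.
  have lt : (2 ^ j < k.+1 * (4 * j + 5))%N by apply: ltn_ceil; lia.
  have k1 : (0 < k)%N by rewrite divn_gt0 ?linear_le_exp2//; lia.
  have : (k.+1 * (4 * j + 5) <= (2 * k) * (5 * j))%N by apply: leq_mul; lia.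
  by lia.
have krho : k%:R <= rho r by apply: le_trans (rhoj j) _; exact: rho_mono.
have lnr : j%:R * ln 2 <= ln r.
  have -> : j%:R * ln 2 = ln (2 ^ j)%:R :> R by rewrite natrX lnXn ?mulr_natl.
  by rewrite ler_ln ?posrE// ltr0n expn_gt0.
have key : k%:R * (j%:R * ln 2) <= rho r * ln r.
  by apply: ler_pM => //; rewrite mulr_ge0// ltW.
have rkj : r <= 20 * (k%:R * j%:R).
  by move: kj; rewrite -(ler_nat R) !natrM; lra.
rewrite ler_pdivlMr//.
have -> : ln 2 / 20 * r = (ln 2 * r) / 20 by ring.
have : ln 2 * r <= ln 2 * (20 * (k%:R * j%:R)) by rewrite ler_pM2l.
move: key; set A := rho r * ln r; set B := k%:R * (j%:R * ln 2).
have -> : ln 2 * (20 * (k%:R * j%:R)) = 20 * B by rewrite /B; ring.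
by set C := ln 2 * r => c1 c2; lra.
Qed.

(** * Generated subgroups *)

Section GeneratedSubgroup.
Variables (H : groupType) (A : seq H).

Definition in_generated : {pred H} := fun g =>
  `[< forall P : {pred H}, group_closed P -> {subset A <= P} -> g \in P >].

Lemma in_generatedP g : reflect
  (forall P : {pred H}, group_closed P -> {subset A <= P} -> g \in P)
  (g \in in_generated).
Proof. exact: asboolP. Qed.

Lemma in_generated_closed : group_closed in_generated.
Proof.
split=> [|u v /in_generatedP uP /in_generatedP vP]; apply/in_generatedP=> P cP sP.
  by case: cP.
by case: (cP) => _; apply; [exact: uP|exact: vP].
Qed.

Lemma sub_in_generated : {subset A <= in_generated}.
Proof. by move=> g gA; apply/in_generatedP => P _; exact. Qed.

Record generated := Generated {gval : H; gvalP : gval \in in_generated}.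

HB.instance Definition _ := [isSub for gval].
HB.instance Definition _ := [Choice of generated by <:].
HB.instance Definition _ :=
  SubChoice_isSubGroup.Build H in_generated generated in_generated_closed.

Lemma gvalM (u v : generated) : gval (u * v)%g = (gval u * gval v)%g.
Proof. by []. Qed.

Lemma gval1 : gval (1 : generated)%g = 1%g.
Proof. by []. Qed.

Lemma gvalV (u : generated) : gval u^-1%g = (gval u)^-1%g.
Proof. by []. Qed.

Lemma gvalX (u : generated) n : gval (u ^+ n)%g = (gval u ^+ n)%g.
Proof. by elim: n => [|n IH] //; rewrite !expgS gvalM IH. Qed.

Lemma generated_by (P : {pred generated}) : group_closed P ->
  (forall u, gval u \in A -> u \in P) -> forall u, u \in P.
Proof.
move=> [P1 PB] AP u.
pose Q : {pred H} := fun g => `[< exists2 v : generated, v \in P & gval v = g >].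
have QP g : reflect (exists2 v : generated, v \in P & gval v = g) (g \in Q).
  exact: asboolP.
have /QP[v vP vu] : gval u \in Q.
  have /in_generatedP := gvalP u; apply.
    split=> [|g h /QP[v vP <-] /QP[w wP <-]]; apply/QP; first by exists 1%g.
    by exists (v / w)%g => //; exact: PB.
  move=> g gA; apply/QP; exists (Generated (sub_in_generated gA)) => //.
  by apply: AP.
by have -> : u = v by exact: val_inj.
Qed.

End GeneratedSubgroup.

Section SubgroupAction.
Variables (R : realType) (H : groupType) (A : seq H) (X : metricType R).
Variable act : H -> X -> X.
Local Notation G := (generated A).
Definition restrict_act (g : G) (x : X) := act (gval g) x.

Lemma restrict_isometric : isometric_action act -> isometric_action restrict_act.
Proof.
move=> [act1 actM acti]; split=> [x|g h x|g x y]; rewrite /restrict_act.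
- by rewrite gval1 act1.
- by rewrite gvalM actM.
- exact: acti.
Qed.

Lemma restrict_acylindrical : acylindrical act -> acylindrical restrict_act.
Proof.
move=> acy d /acy[M [N [M0 MN]]]; exists M, N; split=> // x y /MN.
move=> /pcard_leP/injfunPex[k kN kinj]; apply/pcard_leP/injfunPex.
exists (k \o @gval H A) => [g /kN //|g h gP hP /= kgh].
apply: val_inj; exact: kinj.
Qed.

End SubgroupAction.

(** * Reduction to a large group acting on a tree *)

Section Criterion.
Variables (R : realType) (H : groupType) (L : tree_length H) (ht : H -> int).
Variables a0 y0 z0 s0 c0 : H.
Hypotheses (stab : small_stabilizers L)
  (htM : forall g h, ht (g * h)%g = ht g + ht h)
  (hta : ht a0 = 0) (hty : ht y0 = 0) (htz : ht z0 = 0) (hts : ht s0 = 0)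
  (htc : ht c0 = 1)
  (La : forall n, L (a0 ^+ n)%g = (2 * n)%N)
  (Ly : (L y0 <= 2)%N) (Lz : (L z0 <= 2)%N) (Ls : (L s0 <= 2)%N)
  (Lc : (L c0 <= 2)%N)
  (conj_a : forall j, (a0 ^ (c0 ^+ (2 ^ j)) = a0 * y0^-1 *
     ((s0 ^+ j * z0 * s0 ^- j) * y0 * (s0 ^+ j * z0 * s0 ^- j)^-1))%g).

Local Notation G := (generated [:: a0; y0; z0; s0; c0]).

Let gen_sub (g : H) : g \in [:: a0; y0; z0; s0; c0] -> {u : G | gval u = g}.
Proof. by move=> gA; exists (Generated (sub_in_generated gA)). Qed.

(** The three metric conclusions have different sources: the length L bounds
    distances along the axis from below and gives the tree, the homomorphism ht
    gives the distance of c^m to the axis, and [conj_a] with m = 2^j gives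
    conjugates of logarithmic length. The hypothesis that no generator is
    longer than a itself makes the axis isometrically embedded. *)
Lemma slow_contraction_criterion :
  exists (G : groupType) (S : {fset G}) (a : G),
    [/\ generates S /\ a \in S,
        forall m n : int,
          cay_dist (cay_vertex R S (zpow a m)) (cay_vertex R S (zpow a n))
            = `|m - n|%:~R,
        generalized_loxodromic R a
      & forall rho : R -> R, contraction_gauge rho ->
          limf_einf (fun r : R => (rho r * ln r / r)%:E) +oo = 0%E ->
          ~ contracting (@cay_dist R G S) rho
              [set cay_vertex R S (zpow a n) | n in [set: int]]].
Proof.
have [a aE] : {u : G | gval u = a0} by apply: gen_sub; rewrite !inE eqxx.
have [y yE] : {u : G | gval u = y0} by apply: gen_sub; rewrite !inE eqxx !orbT.
have [z zE] : {u : G | gval u = z0} by apply: gen_sub; rewrite !inE eqxx !orbT.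
have [s sE] : {u : G | gval u = s0} by apply: gen_sub; rewrite !inE eqxx !orbT.
have [c cE] : {u : G | gval u = c0} by apply: gen_sub; rewrite !inE eqxx !orbT.
pose S : {fset G} := [fset a; y; z; s; c]%fset.
have aS : a \in S by rewrite /S !in_fsetE eqxx.
have yS : y \in S by rewrite /S !in_fsetE eqxx !orbT.
have zS : z \in S by rewrite /S !in_fsetE eqxx !orbT.
have sS : s \in S by rewrite /S !in_fsetE eqxx !orbT.
have cS : c \in S by rewrite /S !in_fsetE eqxx !orbT.
have gen : generates S.
  move=> P cP SP; apply: generated_by => // u.
  have AE : [seq gval v | v <- [:: a; y; z; s; c]] = [:: a0; y0; z0; s0; c0].
    by rewrite /= aE yE zE sE cE.
  move=> uA; have : gval u \in [seq gval v | v <- [:: a; y; z; s; c]] by rewrite AE.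
  rewrite (mem_map val_inj) !inE => uS; apply: SP.
  by rewrite /S !in_fsetE -!orbA.
pose D (g h : G) := tdist L (gval g) (gval h).
have aD m n : D (zpow a m) (zpow a n) = (2 * `|(m - n)%R|)%N.
  have -> : D (zpow a m) (zpow a n) = L (gval ((zpow a m)^-1 * zpow a n)%g) by [].
  have [->|->] := zpow_quotient a m n; rewrite ?gvalV ?tlenV gvalX aE; exact: La.
have a_dist m n :
    cay_dist (cay_vertex R S (zpow a m)) (cay_vertex R S (zpow a n)) = `|m - n|%:~R.
  rewrite -(natr_absz R (m - n)).
  apply/eqP; rewrite eq_le; apply/andP; split.
    apply/cay_dist_le/reach_short; have := shortX `|m - n|%N (short_gen aS).
    rewrite muln1; have [->|->] // := zpow_quotient a m n.
    exact: shortV.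
  apply: (@cay_dist_ge R G S D 2) => //; last by rewrite aD.
  - by move=> g; exact: tdistxx.
  - by move=> g h k; exact: tdist_triangle.
  move=> u uS g; rewrite [D (g * u)%g g]tdistC -/(D _ _).
  have -> : D g (g * u)%g = L (gval u) by rewrite /D gvalM tdistMr.
  suff -> : (L (gval u) <= 2)%N by [].
  by move: uS; rewrite /S !in_fsetE => /orP[/orP[/orP[/orP[]|]|]|] /eqP ->;
    rewrite ?aE ?yE ?zE ?sE ?cE ?Ly ?Lz ?Ls ?Lc// -[a0]expg1 La.
exists G, S, a; split=> //.
- exists (tree_space R L), (restrict_act (@tree_act R _ L)); split.
  + exact: tree_hyperbolic.
  + exact/restrict_isometric/tree_isometric_action.
  + exact/restrict_acylindrical/tree_acylindrical/stab.
  exists (vertex R L 1%g), 2, 0; split; [lra|lra|move=> m n].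
  rewrite /restrict_act !tree_act_vertex !mulg1 mdist_vertex.
  rewrite -[tdist _ _ _]/(D _ _) aD -(natr_absz R (m - n)) natrM.
  by have := ler0n R `|m - n|; lra.
move=> rho gauge lim0 ctr; apply: (gauge_lower_bound gauge) lim0 => j.
pose f (g : G) : int := ht (gval g).
pose k := ((2 ^ j) %/ (4 * j + 5))%N.
have conj_short : short S (4 * j + 5) (a ^ (c ^+ (2 ^ j)))%g.
  pose w := (s ^+ j * z * s ^- j)%g.
  have ww : short S (j + 1 + j) w.
    have sj := shortX j (short_gen sS); rewrite muln1 in sj.
    by apply: shortM; [apply: shortM => //; exact: short_gen|exact: shortV].
  have -> : (a ^ (c ^+ (2 ^ j)) = a * y^-1 * (w * y * w^-1))%g.
    have wE : gval w = (s0 ^+ j * z0 * s0 ^- j)%g.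
      by rewrite !gvalM gvalV gvalX sE zE.
    apply: val_inj; rewrite -[LHS]/(gval a ^ gval (c ^+ (2 ^ j)))%g gvalX.
    rewrite -[RHS]/(gval a * (gval y)^-1 * (gval w * gval y * (gval w)^-1))%g.
    by rewrite aE yE cE wE conj_a.
  (* The word a y^-1 w y w^-1, with w of length 2j + 1. *)
have -> : (4 * j + 5 = (1 + 1) + ((j + 1 + j) + 1 + (j + 1 + j)))%N by lia.
  apply: shortM; first by apply: shortM; [|apply: shortV]; exact: short_gen.
  apply: shortM; last exact: shortV.
  by apply: shortM => //; exact: short_gen.
apply: (slow_contraction (f := f) gen cS _ _ _ _ conj_short _ _ ctr).
- by move=> g h; exact: htM.
- by move=> u; rewrite /S !in_fsetE => /orP[/orP[/orP[/orP[]|]|]|] /eqP ->;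
    rewrite /f ?aE ?yE ?zE ?sE ?cE ?hta ?hty ?htz ?hts ?htc.
- by rewrite /f aE hta.
- by rewrite /f cE htc.
- exact: leq_trunc_div.
have := a_dist 0 k; rewrite !zpow_nat expg0 => ->.
by rewrite -natr_absz ler_nat; lia.
Qed.

End Criterion.

(** * Free products of copies of a group *)

Section ReducedWords.
Variables (I : choiceType) (V : groupType).
Implicit Types (p q : I * V) (w s : seq (I * V)).
Local Open Scope group_scope.

Definition starts (i : I) w := if w is p :: _ then p.1 == i else false.

Fixpoint reduced w :=
  if w is p :: s then [&& p.2 != 1, ~~ starts p.1 s & reduced s] else true.

(** Left multiplication by a syllable. On reduced words this is an action of
    each factor ([lmulM]), and associativity of the product follows from that. *)
Definition lmul p w :=
  if p.2 == 1 then w else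
  if w is q :: s then
    if p.1 == q.1 then if p.2 * q.2 == 1 then s else (q.1, p.2 * q.2) :: s
    else p :: w
  else [:: p].

Definition fmul w1 w2 := foldr lmul w2 w1.

Lemma lmul_cons p w : p.2 != 1 -> ~~ starts p.1 w -> lmul p w = p :: w.
Proof.
by rewrite /lmul => /negPf ->; case: w => //= q s; rewrite eq_sym => /negPf ->.
Qed.

Lemma lmul1 i w : lmul (i, 1) w = w.
Proof. by rewrite /lmul eqxx. Qed.

Lemma lmul_reduced p w : reduced w -> reduced (lmul p w).
Proof.
rewrite /lmul; case: ifPn => // p1; case: w => [|q s] /= => [_|/and3P[q1 qs rs]].
  by rewrite p1.
case: (eqVneq p.1 q.1) => [pq|pq]; last by rewrite /= p1 eq_sym pq q1 qs rs.
by case: ifPn => // pq1; rewrite /= pq1 qs rs.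
Qed.

Lemma lmulM i v u w : reduced w -> lmul (i, v) (lmul (i, u) w) = lmul (i, v * u) w.
Proof.
move=> rw; case: (eqVneq u 1) => [->|u1]; first by rewrite lmul1 mulg1.
case: (eqVneq v 1) => [->|v1]; first by rewrite lmul1 mul1g.
case: w rw => [|[j t] s] /= => [_|/and3P[t1 js rs]].
  by rewrite /lmul /= (negPf u1) (negPf v1) eqxx.
case: (eqVneq i j) => [ij|ij]; last first.
  by rewrite /lmul /= (negPf u1) (negPf ij) (negPf v1) eqxx.
rewrite -ij in js *.
rewrite {2}/lmul /= (negPf u1) eqxx; case: (eqVneq (u * t) 1) => ut.
  rewrite lmul_cons//= /lmul /= eqxx -mulgA ut mulg1 (negPf v1).
  case: eqVneq => // vu; congr ((_, _) :: _).
  by apply: (mulgI u); rewrite ut; apply/(mulgI v); rewrite mulgA vu mul1g mulg1.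
rewrite /lmul /= eqxx (negPf v1) mulgA.
by case: (eqVneq (v * u) 1) => [->|//]; rewrite mul1g (negPf t1).
Qed.

Lemma fmul_reduced w1 w2 : reduced w2 -> reduced (fmul w1 w2).
Proof. by move=> r2; elim: w1 => //= p w1; exact: lmul_reduced. Qed.

Lemma fmul_lmul p w1 w2 : reduced w1 -> reduced w2 ->
  fmul (lmul p w1) w2 = lmul p (fmul w1 w2).
Proof.
case: p => i v; rewrite {1}/lmul /=; case: eqVneq => [->|v1]; first by rewrite lmul1.
case: w1 => [//|[j u] s] /= /and3P[u1 js rs] r2.
case: eqVneq => // ->; rewrite lmulM ?fmul_reduced//.
by case: eqVneq => [->|//]; rewrite lmul1.
Qed.

Lemma fmulA w1 w2 w3 : reduced w2 -> reduced w3 ->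
  fmul w1 (fmul w2 w3) = fmul (fmul w1 w2) w3.
Proof.
by move=> r2 r3; elim: w1 => //= p w1 ->; rewrite fmul_lmul// fmul_reduced.
Qed.

Lemma fmul_cat w1 w2 : reduced (w1 ++ w2) -> fmul w1 w2 = w1 ++ w2.
Proof.
by elim: w1 => //= p s IH /and3P[p1 ps rs]; rewrite IH// lmul_cons.
Qed.

Lemma fmulw0 w : reduced w -> fmul w [::] = w.
Proof. by move=> rw; rewrite fmul_cat cats0. Qed.

Definition sinv p := (p.1, p.2^-1).

(** Defined through [fmul] rather than by reversing the word, so that reducedness
    is inherited. *)
Fixpoint finv w := if w is p :: s then fmul (finv s) [:: sinv p] else [::].

Lemma finv_reduced w : reduced w -> reduced (finv w).
Proof.
case: w => //= p s /and3P[p1 _ _]; apply: fmul_reduced.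
by rewrite /= invg_eq1 p1.
Qed.

Lemma finv_cons p s w : reduced (p :: s) -> reduced w ->
  fmul (finv (p :: s)) w = fmul (finv s) (lmul (sinv p) w).
Proof. by move=> /= /and3P[p1 ps rs] rw; rewrite -fmulA//= invg_eq1 p1. Qed.

Lemma fmulV w : reduced w -> fmul (finv w) w = [::].
Proof.
elim: w => // p s IH rps; rewrite finv_cons//.
have /and3P[p1 ps rs] : [&& p.2 != 1, ~~ starts p.1 s & reduced s] by [].
by rewrite /lmul /= invg_eq1 (negPf p1) eqxx mulVg eqxx IH.
Qed.

(** Twice the Gromov product for the syllable length: a common syllable counts
    2, and a final pair of different syllables from the same factor counts 1,
    because they merge into one syllable. *)
Fixpoint agreement w1 w2 : nat :=
  match w1, w2 with
  | p :: s1, q :: s2 =>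
      if p.1 == q.1 then if p.2 == q.2 then (agreement s1 s2).+2 else 1%N
      else 0%N
  | _, _ => 0%N
  end.

(** The words form a rooted tree in which [agreement] measures how long two
    branches coincide. *)
Lemma agreement_ultra w1 w2 w3 :
  (minn (agreement w1 w2) (agreement w2 w3) <= agreement w1 w3)%N.
Proof.
elim: w1 w2 w3 => [|p s1 IH] [|q s2] [|r s3] //=; rewrite ?minn0 ?min0n //.
case: (eqVneq p.1 q.1) => [->|pq]; last by rewrite min0n.
case: (eqVneq q.1 r.1) => [_|qr]; last by rewrite minn0.
case: (eqVneq p.2 q.2) => [->|pq].
  case: (eqVneq q.2 r.2) => [_|qr]; last by rewrite geq_min leqnn orbT.
  by rewrite !minnSS !ltnS IH.
by rewrite geq_min; case: (p.2 == r.2).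
Qed.

Lemma size_fmulV w1 w2 : reduced w1 -> reduced w2 ->
  (size (fmul (finv w1) w2) + agreement w1 w2 = size w1 + size w2)%N.
Proof.
elim: w1 w2 => [|p s IH] w2 r1 r2; first by rewrite addn0.
have /and3P[p1 ps rs] : [&& p.2 != 1, ~~ starts p.1 s & reduced s] by [].
have apart v w : agreement s ((p.1, v) :: w) = 0%N.
  by case: (s) ps => [//|q s'] /= /negPf ->.
rewrite finv_cons//; have rl := lmul_reduced (sinv p) r2.
case: w2 r2 rl => [|q s2] r2; rewrite /lmul /= invg_eq1 (negPf p1) => rl.
  by have := IH _ rs rl; rewrite apart /= => ->; rewrite addn1 !addn0.
move: rl; case: (eqVneq p.1 q.1) => [pq|pq] rl; last first.
  by have := IH _ rs rl; rewrite apart /=; lia.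
move: rl; rewrite mulg_eq1 eqg_inv; case: (eqVneq p.2 q.2) => [_|_] rl.
  by have := IH _ rs rl; lia.
by have := IH _ rs rl; rewrite -pq apart /=; lia.
Qed.

End ReducedWords.

Section FreeProduct.
Variables (I : choiceType) (V : groupType).

Record free_product := FreeProduct {
  fword : seq (I * V);
  fword_reduced : reduced fword
}.

HB.instance Definition _ := [isSub for fword].
HB.instance Definition _ := [Choice of free_product by <:].

Implicit Types f g h : free_product.

Definition fp_one := @FreeProduct [::] isT.
Definition fp_mul f g :=
  FreeProduct (fmul_reduced (fword f) (fword_reduced g)).
Definition fp_inv f := FreeProduct (finv_reduced (fword_reduced f)).

Lemma fp_mulA : associative fp_mul.
Proof. by move=> f g h; apply: val_inj; apply: fmulA; exact: fword_reduced. Qed.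

Lemma fp_mul1g : left_id fp_one fp_mul.
Proof. by move=> f; apply: val_inj. Qed.

Lemma fp_mulg1 : right_id fp_one fp_mul.
Proof. by move=> f; apply: val_inj; exact: fmulw0 (fword_reduced f). Qed.

Lemma fp_mulVg : left_inverse fp_one fp_inv fp_mul.
Proof. by move=> f; apply: val_inj; exact: fmulV (fword_reduced f). Qed.

Lemma fp_mulgV : right_inverse fp_one fp_inv fp_mul.
Proof.
move=> f; rewrite -[LHS]fp_mul1g -{1}(fp_mulVg (fp_inv f)) -fp_mulA.
by rewrite [X in fp_mul _ X]fp_mulA fp_mulVg fp_mul1g fp_mulVg.
Qed.

HB.instance Definition _ := isGroup.Build free_product
  fp_mulA fp_mul1g fp_mulg1 fp_mulVg fp_mulgV.

Definition fsize f := size (fword f).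

Lemma fsizeVM f g : (fsize (f^-1 * g)%g + agreement (fword f) (fword g)
  = fsize f + fsize g)%N.
Proof. exact: size_fmulV (fword_reduced f) (fword_reduced g). Qed.

Lemma fsize0 f : fsize f = 0%N -> f = 1%g.
Proof. by move=> /size0nil f0; apply: val_inj. Qed.

Lemma fsizeV f : fsize f^-1%g = fsize f.
Proof.
by have := fsizeVM f 1%g; rewrite mulg1 /=; case: (fword f) => [|? ?];
  rewrite !addn0.
Qed.

End FreeProduct.

(** * Semidirect products and letterwise actions *)

Record group_action (C N : groupType) := GroupAction {
  gact :> C -> N -> N;
  gact1 : forall x, gact 1%g x = x;
  gactM : forall g h x, gact (g * h)%g x = gact g (gact h x);
  gact_mul : forall g x y, gact g (x * y)%g = (gact g x * gact g y)%g
}.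

Section GroupActionTheory.
Variables (C N : groupType) (act : group_action C N).
Implicit Types (g : C) (x y : N).

Lemma gact_one g : act g 1%g = 1%g.
Proof. by apply: (mulgI (act g 1%g)); rewrite -gact_mul !mulg1. Qed.

(** The action is a phantom argument: it selects the group structure. *)
Definition semidirect & group_action C N := (N * C)%type.
Local Notation S := (semidirect act).
HB.instance Definition _ := Choice.copy S (N * C)%type.

Definition sd_one : S := (1%g, 1%g).
Definition sd_mul (u v : S) : S := (u.1 * act u.2 v.1, u.2 * v.2)%g.
Definition sd_inv (u : S) : S := (act u.2^-1 u.1^-1, u.2^-1)%g.

Lemma sd_mulA : associative sd_mul.
Proof. by move=> u v w; rewrite /sd_mul /= gact_mul gactM !mulgA. Qed.

Lemma sd_mul1g : left_id sd_one sd_mul.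
Proof. by case=> x g; rewrite /sd_mul /= gact1 !mul1g. Qed.

Lemma sd_mulg1 : right_id sd_one sd_mul.
Proof. by case=> x g; rewrite /sd_mul /= gact_one !mulg1. Qed.

Lemma sd_mulVg : left_inverse sd_one sd_inv sd_mul.
Proof. by case=> x g; rewrite /sd_mul /sd_inv /= -gact_mul !mulVg gact_one. Qed.

Lemma sd_mulgV : right_inverse sd_one sd_inv sd_mul.
Proof. by case=> x g; rewrite /sd_mul /sd_inv /= -gactM !mulgV gact1 mulgV. Qed.

HB.instance Definition _ := isGroup.Build S
  sd_mulA sd_mul1g sd_mulg1 sd_mulVg sd_mulgV.

Lemma semidirectM (u v : S) : (u * v)%g = (u.1 * act u.2 v.1, u.2 * v.2)%g :> S.
Proof. by []. Qed.

Lemma semidirectV (u : S) : u^-1%g = (act u.2^-1 u.1^-1, u.2^-1)%g :> S.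
Proof. by []. Qed.

Lemma semidirectVM (u v : S) :
  (u^-1 * v)%g = (act u.2^-1 (u.1^-1 * v.1), u.2^-1 * v.2)%g :> S.
Proof. by rewrite semidirectM gact_mul. Qed.

Definition sd_inl (x : N) : S := (x, 1%g).
Definition sd_inr (g : C) : S := (1%g, g).

Lemma sd_inlM x y : sd_inl (x * y)%g = (sd_inl x * sd_inl y)%g.
Proof. by rewrite semidirectM /= gact1 mulg1. Qed.

Lemma sd_inrM g h : sd_inr (g * h)%g = (sd_inr g * sd_inr h)%g.
Proof. by rewrite semidirectM /= gact_one mulg1. Qed.

Lemma sd_inrV g : sd_inr g^-1%g = (sd_inr g)^-1%g.
Proof. by rewrite semidirectV /= invg1 gact_one. Qed.

Lemma sd_conj x g : (sd_inl x ^ (sd_inr g)^-1)%g = sd_inl (act g x).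
Proof.
by rewrite conjgE invgK -sd_inrV !semidirectM /= gact1 !mul1g mulg1 mulgV.
Qed.

Lemma sd_inlX x n : sd_inl (x ^+ n)%g = (sd_inl x ^+ n)%g.
Proof. by elim: n => [|n IH] //; rewrite !expgS sd_inlM IH. Qed.

End GroupActionTheory.

(** A group that permutes the factors of a free product, and acts by
    homomorphisms from each factor to its image, acts on the free product. The
    cases used are the permutation of the factors alone, and an action on each
    factor separately. *)
Section LetterAction.
Variables (C : groupType) (I : choiceType) (V : groupType).
Variables (sigma : C -> I -> I) (theta : C -> I -> V -> V).
Hypotheses (sigma1 : forall i, sigma 1%g i = i)
  (sigmaM : forall g h i, sigma (g * h)%g i = sigma g (sigma h i))
  (theta1 : forall i v, theta 1%g i v = v)
  (thetaM : forall g h i v,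
    theta (g * h)%g i v = theta g (sigma h i) (theta h i v))
  (theta_mul : forall g i u v,
    theta g i (u * v)%g = (theta g i u * theta g i v)%g).

Definition letter_map g (p : I * V) := (sigma g p.1, theta g p.1 p.2).

Let sigma_inj g : injective (sigma g).
Proof. by apply: (can_inj (g := sigma g^-1%g)) => i; rewrite -sigmaM mulVg. Qed.

Let theta_one g i : theta g i 1%g = 1%g.
Proof. by apply: (mulgI (theta g i 1%g)); rewrite -theta_mul !mulg1. Qed.

Let theta_eq1 g i v : (theta g i v == 1%g) = (v == 1%g).
Proof.
apply/eqP/eqP => [v1|->//]; rewrite -(theta1 i v) -(mulVg g) thetaM v1.
exact: theta_one.
Qed.

Let map_reduced g w : reduced w -> reduced (map (letter_map g) w).
Proof.
elim: w => //= p s IH /and3P[p1 ps /IH ->]; rewrite theta_eq1 p1 andbT /=.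
by case: s ps {IH} => //= q s; rewrite (inj_eq (@sigma_inj g)).
Qed.

Let map_lmul g p w :
  map (letter_map g) (lmul p w) = lmul (letter_map g p) (map (letter_map g) w).
Proof.
rewrite /lmul /= theta_eq1; case: eqP => // _; case: w => //= q s.
rewrite (inj_eq (@sigma_inj g)); case: eqP => // ->; rewrite -theta_mul theta_eq1.
by case: eqP.
Qed.

Definition letter_fun g (f : free_product I V) :=
  FreeProduct (map_reduced g (fword_reduced f)).

Let letter_fun1 f : letter_fun 1%g f = f.
Proof.
apply: val_inj; rewrite /= -[RHS]map_id; apply: eq_map => -[i v].
by rewrite /letter_map /= sigma1 theta1.
Qed.

Let letter_funM g h f : letter_fun (g * h)%g f = letter_fun g (letter_fun h f).
Proof.
apply: val_inj; rewrite /= -map_comp; apply: eq_map => -[i v].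
by rewrite /letter_map /= sigmaM thetaM.
Qed.

Let letter_fun_mul g f k :
  letter_fun g (f * k)%g = (letter_fun g f * letter_fun g k)%g.
Proof.
apply: val_inj => /=; rewrite /fmul.
by elim: (fword f) => //= p w IH; rewrite map_lmul IH.
Qed.

Definition letter_action : group_action C (free_product I V) :=
  GroupAction letter_fun1 letter_funM letter_fun_mul.

Lemma fsize_letter g f : fsize (letter_action g f) = fsize f.
Proof. by rewrite /fsize size_map. Qed.

End LetterAction.

(** * The syllable length is a tree length *)

Section FreeProductLength.
Variables (C : groupType) (I : choiceType) (V : groupType).
Variable act : group_action C (free_product I V).
Hypothesis fsize_act : forall g f, fsize (act g f) = fsize f.
Local Notation H := (semidirect act).

Definition sd_len (u : H) : nat := fsize u.1.

Let sd_len1 : sd_len 1%g = 0%N.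
Proof. by []. Qed.

Let sd_lenV u : sd_len u^-1%g = sd_len u.
Proof. by rewrite /sd_len semidirectV fsize_act fsizeV. Qed.

Lemma sd_lenVM u v :
  (sd_len (u^-1 * v)%g + agreement (fword u.1) (fword v.1)
    = sd_len u + sd_len v)%N.
Proof. by rewrite /sd_len semidirectVM fsize_act fsizeVM. Qed.

Let sd_len_hyp u v w : (sd_len (u^-1 * w)%g + sd_len v <=
  maxn (sd_len (u^-1 * v)%g + sd_len w) (sd_len (v^-1 * w)%g + sd_len u))%N.
Proof.
have := sd_lenVM u w; have := sd_lenVM u v; have := sd_lenVM v w.
have := agreement_ultra (fword u.1) (fword v.1) (fword w.1).
lia.
Qed.

Lemma take_reduced k (w : seq (I * V)) : reduced w -> reduced (take k w).
Proof.
elim: w k => [|p s IH] [|k] //= /and3P[-> ps /IH ->]; rewrite andbT /=.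
by case: s ps {IH} => [|q s] //; case: k.
Qed.

Lemma agreement_take k (w : seq (I * V)) :
  agreement (take k w) w = (2 * minn k (size w))%N.
Proof.
elim: w k => [|p s IH] [|k] //=; rewrite ?min0n ?minn0 //.
by rewrite !eqxx IH minnSS; lia.
Qed.

Let sd_len_prefix u k : (k <= sd_len u)%N ->
  exists2 v, sd_len v = k & sd_len (v^-1 * u)%g = (sd_len u - k)%N.
Proof.
move=> ku; pose v : H := (FreeProduct (take_reduced k (fword_reduced u.1)), 1%g).
have vk : sd_len v = k by rewrite /sd_len /fsize /= size_takel.
exists v => //; have := sd_lenVM v u; rewrite vk agreement_take.
have -> : minn k (size (fword u.1)) = k by exact/minn_idPl.
lia.
Qed.

Definition sd_tree_length : tree_length H :=
  TreeLength sd_len1 sd_lenV sd_len_hyp sd_len_prefix.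

End FreeProductLength.

(** * The ambient group *)

(** The triple (r, k, n) stands for the affine map t |-> r + 2^k t of the rational
    line together with the integer n; the elements (1, 0, 0), (0, 1, 0) and
    (0, 0, 1) are z, s and c, and z, s satisfy the Baumslag-Solitar relation. *)
Definition affZ : Type := (rat * int * int)%type.
HB.instance Definition _ := Choice.copy affZ (rat * int * int)%type.

Definition affZ_one : affZ := (0, 0, 0).
Definition affZ_mul (g h : affZ) : affZ :=
  (g.1.1 + 2 ^ g.1.2 * h.1.1, g.1.2 + h.1.2, g.2 + h.2).
Definition affZ_inv (g : affZ) : affZ :=
  (- (2 ^ (- g.1.2) * g.1.1), - g.1.2, - g.2).

Lemma exp2D (m n : int) : 2 ^ (m + n) = 2 ^ m * 2 ^ n :> rat.
Proof. exact: expfzDr. Qed.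

Lemma affZ_mulA : associative affZ_mul.
Proof.
move=> [[r k] n] [[r' k'] n'] [[r'' k''] n'']; rewrite /affZ_mul /= exp2D.
by congr (_, _, _); ring.
Qed.

Lemma affZ_mul1g : left_id affZ_one affZ_mul.
Proof.
move=> [[r k] n]; rewrite /affZ_mul /= expr0z.
by congr (_, _, _); ring.
Qed.

Lemma affZ_mulg1 : right_id affZ_one affZ_mul.
Proof.
by move=> [[r k] n]; rewrite /affZ_mul /=; congr (_, _, _); ring.
Qed.

Lemma affZ_mulVg : left_inverse affZ_one affZ_inv affZ_mul.
Proof.
by move=> [[r k] n]; rewrite /affZ_mul /affZ_inv /=; congr (_, _, _); ring.
Qed.

Lemma affZ_mulgV : right_inverse affZ_one affZ_inv affZ_mul.
Proof.
move=> [[r k] n]; rewrite /affZ_mul /affZ_inv /=.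
by congr (_, _, _); rewrite ?mulrN ?mulrA -?exp2D ?subrr// expr0z mul1r subrr.
Qed.

HB.instance Definition _ := isGroup.Build affZ
  affZ_mulA affZ_mul1g affZ_mulg1 affZ_mulVg affZ_mulgV.

(** Two actions on the set of affine maps t |-> u + 2^j t. For b = false, only the
    affine part acts, by left multiplication, and the stabilizer of the identity
    map is generated by c = (0, 0, 1). For b = true, the integer n acts in
    addition by right multiplication with the translation by -n, and the
    stabilizer of the identity map is generated by (1, 0, 1), that is, c z. *)
Definition affZ_act (b : bool) (g : affZ) (i : rat * int) : rat * int :=
  (g.1.1 + 2 ^ g.1.2 * i.1 - (2 ^ (g.1.2 + i.2) * g.2%:~R) *+ b, g.1.2 + i.2).

Lemma affZ_act1 b i : affZ_act b 1%g i = i.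
Proof.
by case: i => t j; rewrite /affZ_act /= expr0z mulr0 mul0rn; congr (_, _); ring.
Qed.

Lemma affZ_actM b g h i :
  affZ_act b (g * h)%g i = affZ_act b g (affZ_act b h i).
Proof.
case: g => [[r k] n]; case: h => [[r' k'] n']; case: i => t j.
rewrite /affZ_act /= !exp2D intrD; case: b; rewrite ?mulr1n ?mulr0n;
by congr (_, _); ring.
Qed.

(** Conjugates of c have no affine part, whereas those of c z have a translation
    part proportional to their integer. *)
Lemma affZ_stab g i j : affZ_act false g i = i -> affZ_act true g j = j ->
  g = 1%g.
Proof.
case: g => [[r k] n]; case: i => t i; case: j => u j.
rewrite /affZ_act /= mulr0n mulr1n => -[ti ki] [uj _].
have k0 : k = 0 by lia.
move: ti uj; rewrite k0 expr0z !mul1r subr0 add0r => tr un.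
have r0 : r = 0 by lra.
have : 2 ^ j * n%:~R = 0 :> rat by lra.
by move=> /eqP; rewrite mulf_eq0 expfz_eq0 andbF /= intr_eq0 r0 => /eqP ->.
Qed.

Definition swap : {perm bool} := tperm true false.

Lemma swap_neq1 : swap != 1%g.
Proof. by apply/eqP => /permP /(_ true); rewrite tpermL perm1. Qed.

Local Notation W := (free_product (rat * int)%type {perm bool}).

(** The factor of F with label b: a free product of groups of order two indexed
    by affine maps and permuted by [affZ_act b]. *)
Definition index_action (b : bool) : group_action affZ W :=
  @letter_action affZ (rat * int)%type {perm bool} (affZ_act b)
    (fun _ _ v => v) (affZ_act1 b) (@affZ_actM b) (fun _ _ => erefl)
    (fun _ _ _ _ => erefl) (fun _ _ _ _ => erefl).

Definition ambient_action : group_action affZ (free_product bool W) :=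
  @letter_action affZ bool W (fun _ b => b) (fun g b => index_action b g)
    (fun _ => erefl) (fun _ _ _ => erefl)
    (fun b v => gact1 (index_action b) v)
    (fun g h b v => gactM (index_action b) g h v)
    (fun g b u v => gact_mul (index_action b) g u v).

Definition ambient_group : groupType := semidirect ambient_action.

Definition ambient_length : tree_length ambient_group :=
  sd_tree_length (act := ambient_action) (fsize_letter _ _ _ _ _).

Lemma index_action_fixed b g (v : W) : v != 1%g -> index_action b g v = v ->
  exists i, affZ_act b g i = i.
Proof.
move=> v1 /(congr1 (@fword _ _)) /=; case E : (fword v) => [|[i u] s] /=.
  have v1' : v = 1%g by apply: val_inj.
  by rewrite v1' eqxx in v1.
by case=> gi *; exists i.
Qed.

(** An element with L k = 0 is some g of [affZ]; it fixes p when it fixes the word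
    of p, hence its first two syllables, which belong to different factors, and
    therefore an index in each factor. *)
Lemma ambient_small_stabilizers : small_stabilizers ambient_length.
Proof.
have LE u : ambient_length u = fsize u.1 by [].
move=> k p; rewrite !LE semidirectVM fsize_letter semidirectM.
case: k p => [f g] [w h] /= /fsize0 -> /fsize0.
rewrite mul1g => /mulg1_eq.
rewrite invgK => /(congr1 (@fword _ _)) /=; rewrite /fsize.
have := fword_reduced w; case: (fword w) => [//|[b u] [//|[b' v] s]] /=.
move=> /andP[u1 /andP[bb /andP[v1 _]]] [eu ev _] _.
have [i gi] := index_action_fixed u1 (esym eu).
have [j gj] := index_action_fixed v1 (esym ev).
suff -> : g = 1%g by [].
case: b b' bb gi gj {eu ev} => -[] //= _ gi gj;
  first [exact: affZ_stab gj gi|exact: affZ_stab gi gj].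
Qed.

Lemma reduced1 (I : choiceType) (V : groupType) (i : I) (v : V) :
  v != 1%g -> reduced [:: (i, v)].
Proof. by move=> v1; rewrite /= v1. Qed.

Definition letter (I : choiceType) (V : groupType) (i : I) (v : V)
  (v1 : v != 1%g) : free_product I V := FreeProduct (reduced1 i v1).

Lemma letter_neq1 (I : choiceType) (V : groupType) (i : I) (v : V)
  (v1 : v != 1%g) : letter i v1 != 1%g.
Proof. by apply/eqP => /(congr1 (@fword _ _)). Qed.

Local Notation inl := (@sd_inl _ _ ambient_action).
Local Notation inr := (@sd_inr _ _ ambient_action).

Definition gen_letter (b : bool) (i : rat * int) : free_product bool W :=
  letter b (letter_neq1 i swap_neq1).

Lemma gen_conj b i g : (inl (gen_letter b i) ^ (inr g)^-1)%g =
  inl (gen_letter b (affZ_act b g i)) :> ambient_group.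
Proof.
rewrite sd_conj; congr inl.
by apply: val_inj; congr [:: (b, _)]; apply: val_inj.
Qed.

Definition elt_c (n : int) : ambient_group := inr (0, 0, n).
Definition elt_z (r : rat) : ambient_group := inr (r, 0, 0).
Definition elt_s (k : int) : ambient_group := inr (0, k, 0).

Definition letter_x : ambient_group := inl (gen_letter false (0, 0)).
Definition letter_y : ambient_group := inl (gen_letter true (0, 0)).
Definition axis_elt : ambient_group := (letter_x * letter_y)%g.

Lemma elt_cX n : (elt_c 1 ^+ n)%g = elt_c n.
Proof.
by elim: n => [|n IH] //; rewrite expgS IH -sd_inrM; congr inr.
Qed.

Lemma elt_sX n : (elt_s 1 ^+ n)%g = elt_s n.
Proof.
by elim: n => [|n IH] //; rewrite expgS IH -sd_inrM; congr inr.
Qed.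

Lemma elt_sz n : (elt_s 1 ^+ n * elt_z 1 * elt_s 1 ^- n)%g = elt_z (2 ^+ n).
Proof.
rewrite elt_sX -sd_inrV -!sd_inrM; congr inr.
by congr (_, _, _) => /=; rewrite ?add0r ?mulr0 ?oppr0 ?mulr1 ?addr0 ?subrr.
Qed.

Lemma affZ_act_c b n : affZ_act b ((0, 0, n) : affZ)^-1%g (0, 0) = (n%:~R *+ b, 0).
Proof.
rewrite /affZ_act; congr (_, _) => /=.
by rewrite !(mulr0, oppr0, addr0, add0r, expr0z, mul1r) mulrNz mulNrn opprK.
Qed.

Lemma affZ_act_z b r : affZ_act b ((r, 0, 0) : affZ) (0, 0) = (r, 0).
Proof.
rewrite /affZ_act; congr (_, _) => /=.
by rewrite !(mulr0, addr0, mul0rn, subr0).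
Qed.

(** The element c fixes x, and moves y exactly as z^-1 does. *)
Lemma conj_axis_elt n : (axis_elt ^ (elt_c 1 ^+ n))%g =
  (axis_elt * letter_y^-1 * (elt_z n%:R * letter_y * (elt_z n%:R)^-1))%g.
Proof.
rewrite mulgK conjMg elt_cX.
have conj_c b : (inl (gen_letter b (0, 0)) ^ elt_c n)%g =
    inl (gen_letter b (n%:R *+ b, 0)).
  by rewrite -[elt_c n]invgK /elt_c -sd_inrV gen_conj affZ_act_c.
rewrite !conj_c mulr0n mulr1n; congr (_ * _)%g.
have -> : (elt_z n%:R * letter_y * (elt_z n%:R)^-1 = letter_y ^ (elt_z n%:R)^-1)%g.
  by rewrite conjgE invgK mulgA.
by rewrite gen_conj affZ_act_z.
Qed.

(** The word x y begins and ends in different factors, so its concatenated copies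
    are reduced. *)
Lemma axis_elt_length n : ambient_length (axis_elt ^+ n)%g = (2 * n)%N.
Proof.
have aE : axis_elt = inl (gen_letter false (0, 0) * gen_letter true (0, 0))%g.
  by rewrite sd_inlM.
rewrite aE -sd_inlX; set f := (_ * _)%g.
have fE : fword f = [:: (false, letter (0, 0) swap_neq1);
                        (true, letter (0, 0) swap_neq1)].
  by [].
have fn : fword (f ^+ n)%g = flatten (nseq n (fword f)).
  elim: n => // n IH; rewrite expgS.
  have -> : fword (f * f ^+ n)%g = fmul (fword f) (fword (f ^+ n)%g) by [].
  rewrite IH; apply: fmul_cat.
  have -> : fword f ++ flatten (nseq n (fword f)) = flatten (nseq n.+1 (fword f)) by [].
  rewrite fE; elim: n.+1 => // k IHk; rewrite /= IHk.
  by case: (k).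
have -> : ambient_length (inl (f ^+ n)%g) = size (fword (f ^+ n)%g) by [].
by rewrite fn size_flatten /shape map_nseq sumn_nseq fE.
Qed.

Theorem theorem1p2 (R : realType) :
  exists (G : groupType) (S : {fset G}) (a : G),
    [/\ generates S /\ a \in S,
        forall m n : int,
          cay_dist (cay_vertex R S (zpow a m)) (cay_vertex R S (zpow a n))
            = `|m - n|%:~R,
        generalized_loxodromic R a
      & forall rho : R -> R, contraction_gauge rho ->
          limf_einf (fun r : R => (rho r * ln r / r)%:E) +oo = 0%E ->
          ~ contracting (@cay_dist R G S) rho
              [set cay_vertex R S (zpow a n) | n in [set: int]]].
Proof.
apply: (@slow_contraction_criterion R ambient_group ambient_length
  (fun u => u.2.2) axis_elt letter_y (elt_z 1) (elt_s 1) (elt_c 1)).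
- exact: ambient_small_stabilizers.
- by move=> g h; rewrite semidirectM.
- by rewrite /axis_elt semidirectM.
- by [].
- by [].
- by [].
- by [].
- exact: axis_elt_length.
- by [].
- by [].
- by [].
- by [].
- by move=> j; rewrite elt_sz -natrX; exact: conj_axis_elt.
Qed.
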